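(* Let $\mathfrak g$ be a complex simple Lie algebra of rank $l>1$ with Coxeter number $s$, let $E_+=\sum_{i=0}^l\sqrt{q_i}\,e_{\alpha_i}$, and let $\mathfrak h'=\mathfrak g^{E_+}$ be its centralizer, with root system $\Delta'$. Write $E_+=\mathrm{Re}(E_+)+\sqrt{-1}\,\mathrm{Im}(E_+)$ with $\mathrm{Re}(E_+),\mathrm{Im}(E_+)\in\mathfrak h'_\sharp$, let $Y\subset\mathfrak h'_\sharp$ be the real plane spanned by $\mathrm{Re}(E_+),\mathrm{Im}(E_+)$ (the Coxeter Plane), and let $Q:\mathfrak h'_\sharp\to Y$ be the orthogonal projection. Identify $Y$ with $\mathbb C$ by identifying the orthonormal basis $(2/s)^{\frac12}\mathrm{Re}(E_+),\ (2/s)^{\frac12}\mathrm{Im}(E_+)$ with $1,\sqrt{-1}$. Then, for all $\beta\in\Delta'$, the point $Q(H_\beta)$ is identified with the point $(2/s)^{\frac12}\beta(E_+)\in\mathbb C$.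
   Context: $\mathfrak h$ is a Cartan subalgebra of $\mathfrak g$ with simple roots $\alpha_1,\dots,\alpha_l$, highest root $\psi=\sum_{i=1}^lq_i\alpha_i$, $q_0=1$, $\alpha_0=-\psi$, $s=\sum_{i=0}^lq_i$. $B$ is a positive multiple of the Killing form. The root vectors $e_\alpha\in\mathfrak g_\alpha$ (roots with respect to $\mathfrak h$) satisfy $B(e_\alpha,e_{-\alpha})=1$, and $[e_\alpha,e_\beta]=N_{\alpha,\beta}e_{\alpha+\beta}$ with $N_{-\alpha,-\beta}=-N_{\alpha,\beta}$. The element $E_+$ is regular semisimple, so $\mathfrak h'$ is a Cartan subalgebra; $\mathfrak h'_\sharp=\{X\in\mathfrak h' : \beta(X)\in\mathbb R\ \forall\beta\in\Delta'\}$ is a real form of $\mathfrak h'$ on which $B$ is positive definite, and orthogonality is with respect to $B|_{\mathfrak h'_\sharp}$. For $\beta\in\Delta'$, $H_\beta\in\mathfrak h'$ is defined by $B(h,H_\beta)=\beta(h)$ for all $h\in\mathfrak h'$. *)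

(* Defs.v *)
From HB Require Import structures.
From mathcomp Require Import all_boot all_order all_algebra.
From mathcomp Require Import reals complex.

Set Implicit Arguments.
Unset Strict Implicit.
Unset Printing Implicit Defensive.

Import Order.TTheory GRing.Theory Num.Theory.
Local Open Scope ring_scope.
Local Open Scope complex_scope.

HB.mixin Record Vector_isLieAlgebra (K : fieldType) g of Vector K g := {
  lie : g -> g -> g;
  lie_is_linear_l : forall y : g, linear (lie^~ y);
  lie_is_linear_r : forall x : g, linear (lie x);
  liexx : forall x : g, lie x x = 0;
  lie_jacobi : forall x y z : g,
    lie x (lie y z) + lie y (lie z x) + lie z (lie x y) = 0 }.

#[short(type="lieAlgType")]
HB.structure Definition LieAlgebra (K : fieldType) :=
  {g of Vector_isLieAlgebra K g & Vector K g}.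

Section LieAlgebras.
Variables (K : fieldType) (g : lieAlgType K).
Implicit Types (x y : g) (I h : {vspace g}).

Definition ad x : 'End(g) := linfun (lie x).

Definition centralizer x : {vspace g} := lker (ad x).

Definition mx_of_end (f : 'End(g)) := passmx.mxof (vbasis {:g}) (vbasis {:g}) f.

Definition killing x y : K := \tr (mx_of_end (ad x \o ad y)%VF).

Definition is_ideal I := forall x y, y \in I -> lie x y \in I.

Definition is_simple :=
  (exists x y, lie x y <> 0) /\
  (forall I, is_ideal I -> I = 0%VS \/ I = {:g}%VS).

Definition is_abelian h := forall x y, x \in h -> y \in h -> lie x y = 0.

(* A Cartan subalgebra of a complex semisimple Lie algebra: a maximal abelian
   subalgebra all of whose elements are ad-semisimple. *)
Definition is_cartan h :=
  [/\ is_abelian h,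
      forall h' : {vspace g}, is_abelian h' -> (h <= h')%VS -> h' = h
    & forall x, x \in h -> diagonalizable (mx_of_end (ad x))].

Definition dual h := 'Hom(subvs_of h, K^o).

(* [vsproj h x] is [x] seen as an element of [h]; this is only meaningful for
   [x \in h], and is only used there. *)
Definition eval_dual h (beta : dual h) x : K := beta (vsproj h x).

Definition in_root_space h (beta : dual h) x :=
  forall y, y \in h -> lie y x = eval_dual beta y *: x.

Definition is_root h (beta : dual h) :=
  beta <> 0 /\ (exists2 x, x <> 0 & in_root_space beta x).

Definition is_simple_system h l (alpha : 'I_l -> dual h) :=
  [/\ forall i, is_root (alpha i),
      basis_of {: dual h} [seq alpha i | i : 'I_l]
    & forall beta : dual h, is_root beta -> exists n : 'I_l -> nat,
        beta = \sum_(i < l) alpha i *+ n i \/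
        beta = - \sum_(i < l) alpha i *+ n i].

(* psi is the largest root for the partial order defined by alpha. *)
Definition is_highest_root h l (alpha : 'I_l -> dual h) (psi : dual h) :=
  is_root psi /\
  (forall beta : dual h, is_root beta ->
     exists n : 'I_l -> nat, psi - beta = \sum_(i < l) alpha i *+ n i).

Definition is_root_vectors (B : g -> g -> K) h
    (e : dual h -> g) (N : dual h -> dual h -> K) :=
  [/\ forall a : dual h, is_root a -> in_root_space a (e a),
      forall a : dual h, is_root a -> B (e a) (e (- a)) = 1
    & forall a b : dual h, is_root a -> is_root b -> is_root (a + b) ->
        lie (e a) (e b) = N a b *: e (a + b) /\ N (- a) (- b) = - N a b].

(* H is the vector H_beta of h representing beta with respect to B. *)
Definition is_dual_vector (B : g -> g -> K) h (beta : dual h) (H : g) :=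
  H \in h /\ (forall x, x \in h -> B x H = eval_dual beta x).

End LieAlgebras.

(* The family indexed by {0, ..., l} extending a family indexed by
   {1, ..., l}: [f i] (i : 'I_l) is the entry of index i + 1. *)
Definition extend0 (T : Type) l (x0 : T) (f : 'I_l -> T) (i : 'I_l.+1) : T :=
  if unlift ord0 i is Some j then f j else x0.

Definition coxeter_number l (q : 'I_l -> nat) : nat :=
  (\sum_(i < l.+1) extend0 1 q i)%N.

Section Complex.
Variables (R : realType) (g : lieAlgType R[i]).
Implicit Types (x y u v : g) (B : g -> g -> R[i]).

Definition E_plus (h : {vspace g}) l (e : dual h -> g)
    (alpha : 'I_l -> dual h) (psi : dual h) (q : 'I_l -> nat) : g :=
  \sum_(i < l.+1)
    (Num.sqrt ((extend0 1%N q i)%:R : R))%:C *: e (extend0 (- psi) alpha i).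

Definition real_part (h : {vspace g}) x :=
  x \in h /\
  (forall beta : dual h, is_root beta -> eval_dual beta x \is Num.real).

Definition plane u v x := exists a b : R, x = a%:C *: u + b%:C *: v.

Definition orthonormal_pair B u v :=
  [/\ B u u = 1, B v v = 1 & B u v = 0].

Definition is_orthogonal_projection B (V Y : g -> Prop) (Q : g -> g) :=
  forall x, V x -> Y (Q x) /\ (forall y, Y y -> B (x - Q x) y = 0).

Definition point_of_complex u v (z : R[i]) : g :=
  (complex.Re z)%:C *: u + (complex.Im z)%:C *: v.

End Complex.

(* Main.v *)
Require Import Defs.
From HB Require Import structures.
From mathcomp Require Import all_boot all_order all_algebra.
From mathcomp Require Import reals complex.
From mathcomp Require boolp.
From mathcomp Require Import ring.

(** The root theory behind [star] is drawn from traces rather than from representations of sl2.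
    Since [[e_a, e_-a] = t_a], tracing it over part of a root string gives rational ratios
    [b(t_a) / a(t_a)], then [a(t_a) > 0], then root spaces of dimension 1, then a nonnegative
    eigenvalue for [ad e_a ad e_-a]. By the sign rule on [N] that eigenvalue is a square of a
    structure constant, which is why the constants are real. The square roots in [E_+] are what
    makes both computations with [star] close up: each coefficient meets itself, so
    [[E_+, star E_+]] is the vector dual to [sum_i q_i a_i] and [B E_+ (star E_+)] is
    [sum_i q_i = s]. This [s] splits evenly between real and imaginary part, whence the factor
    [(2/s)^(1/2)]. The obstacle is that [h'] is only given as a centralizer: before its roots can be
    used, it has to be shown abelian and acting diagonalizably. The grading serves this purpose:
    [psi] has height [s - 1], so all summands of [E_+] have degree 1 modulo [s], while no root has
    degree 0. *)

(** Let [e_a -> e_-a], [t_a -> t_a] (with [t_a] dual to the root [a]) be extended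
    antilinearly to [star]; up to sign it is the conjugation of a compact real form.
    The structure constants being real, [star] reverses brackets, and
    [B x (star y)] is a definite form for which [ad (star x)] is adjoint to [ad x].
    By [sum_i q_i a_i = 0], [E_+] commutes with [star E_+], so [ad E_+] is normal.
    Heights modulo [s] grade the centralizer [h'] of [E_+] by [Z/s], and [h'] has
    no component of degree 0; Kreknin's argument, in which normal nilpotent
    operators vanish, shows that [h'] is abelian. So every [ad x], [x] in [h'], is
    normal, and the [x] in [h'] on which all roots are real are the fixed points
    of [star].  Hence [star E_+ = Re E_+ - i Im E_+], and the Gram matrix of
    [Re E_+, Im E_+] follows from [B E_+ E_+ = 0], which needs [l > 1],
    and [B E_+ (star E_+) = s]. *)

Set Implicit Arguments.
Unset Strict Implicit.
Unset Printing Implicit Defensive.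

Import Order.TTheory GRing.Theory Num.Theory.
(* The linear structures of [rVof] and [vecof] are only active after this. *)
Import passmx.
Local Open Scope ring_scope.

(** * Lie brackets, traces and the Killing form *)

Section LieBasics.
Variables (K : fieldType) (g : lieAlgType K).
Implicit Types (x y z : g).

HB.instance Definition _ x :=
  GRing.isSemilinear.Build K g g _ (lie x) (GRing.semilinear_linear (lie_is_linear_r x)).

Lemma lieDl x y z : lie (x + y) z = lie x z + lie y z.
Proof. by have := lie_is_linear_l z 1 x y; rewrite !scale1r. Qed.

Lemma lie0l x : lie 0 x = 0.
Proof. by apply: (addrI (lie 0 x)); rewrite -lieDl !addr0. Qed.

Lemma lieZl a x y : lie (a *: x) y = a *: lie x y.
Proof. by have := lie_is_linear_l y a x 0; rewrite lie0l !addr0. Qed.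

Lemma lie_suml (I : Type) (r : seq I) (P : pred I) (F : I -> g) x :
  lie (\sum_(i <- r | P i) F i) x = \sum_(i <- r | P i) lie (F i) x.
Proof.
by elim/big_rec2: _ => [|i y1 y2 _ <-]; rewrite ?lie0l ?lieDl.
Qed.

Lemma lieC x y : lie x y = - lie y x.
Proof.
apply/eqP; rewrite -addr_eq0; apply/eqP.
by have := liexx (x + y); rewrite lieDl !linearD /= !liexx addr0 add0r.
Qed.

Lemma lie_lie x y z : lie x (lie y z) = lie (lie x y) z + lie y (lie x z).
Proof.
have /eqP := lie_jacobi x y z.
rewrite (lieC z (lie x y)) (lieC z x) linearN /= subr_eq0 => /eqP <-.
by rewrite subrK.
Qed.

Lemma adE x y : ad x y = lie x y.
Proof. by rewrite lfunE. Qed.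

Lemma ad_lie x y : ad (lie x y) = ((ad x \o ad y) - (ad y \o ad x))%VF.
Proof.
apply/lfunP => z; rewrite add_lfunE opp_lfunE !comp_lfunE !adE.
by rewrite lie_lie addrK.
Qed.

Lemma ad_linear (a : K) x y : ad (a *: x + y) = a *: ad x + ad y.
Proof.
by apply/lfunP => z; rewrite add_lfunE scale_lfunE !adE lieDl lieZl.
Qed.

Lemma centralizerP x y : reflect (lie x y = 0) (y \in centralizer x).
Proof. by rewrite memv_ker adE; apply: eqP. Qed.

Definition tr_end (f : 'End(g)) := \tr (mx_of_end f).

(** The Killing form is defined in the fixed basis [vbasis]; the change of basis makes it computable
    in a basis of weight vectors. *)
Lemma tr_endE (b : (\dim {:g}).-tuple g) f : basis_of {:g} b ->
  tr_end f = \sum_i coord b i (f b`_i).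
Proof.
move=> bb; rewrite /tr_end /mx_of_end; set v := vbasis _.
have vb : basis_of {:g} v by apply: vbasisP.
have -> : passmx.mxof v v f =
    passmx.mxof v b \1 *m passmx.mxof b b f *m passmx.mxof b v \1.
  by rewrite -!(passmx.mxof_comp _ _ bb) comp_lfun1l comp_lfun1r.
rewrite mxtrace_mulC mulmxA -(passmx.mxof_comp _ _ vb) comp_lfun1l passmx.mxof1 ?mul1mx.
  by apply: eq_bigr => i _; rewrite !mxE /= passmx.vecof_delta.
exact: basis_free bb.
Qed.

Lemma tr_endC (f1 f2 : 'End(g)) : tr_end (f1 \o f2)%VF = tr_end (f2 \o f1)%VF.
Proof.
have vb := vbasisP {:g}.
by rewrite /tr_end /mx_of_end !(passmx.mxof_comp _ _ vb) mxtrace_mulC.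
Qed.

Lemma tr_end_linear a (f1 f2 : 'End(g)) :
  tr_end (a *: f1 + f2) = a * tr_end f1 + tr_end f2.
Proof.
by rewrite /tr_end /mx_of_end passmx.mxof_linear mxtraceD mxtraceZ.
Qed.

Lemma killingC x y : killing x y = killing y x.
Proof. exact: tr_endC. Qed.

Lemma killing_linearl a x y z :
  killing (a *: x + y) z = a * killing x z + killing y z.
Proof.
by rewrite /killing ad_linear comp_lfunDl -comp_lfunZl; apply: tr_end_linear.
Qed.

Lemma killing_lie x y z : killing (lie x y) z = killing x (lie y z).
Proof.
rewrite /killing !ad_lie comp_lfunDl comp_lfunDr comp_lfunNl comp_lfunNr.
rewrite -/(tr_end _) -/(tr_end _) ![((_ \o _) - _)%VF]addrC -!scaleN1r !tr_end_linear.
by rewrite comp_lfunA -(comp_lfunA (ad y)) (tr_endC (ad y)) -!comp_lfunA.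
Qed.

End LieBasics.

(** * Linear forms represented by a bilinear form *)

Section Represent.
Variables (K : fieldType) (V : vectType K) (U : {vspace V}) (B : V -> V -> K).
Hypothesis B_linl : forall x a y z, B (a *: y + z) x = a * B y x + B z x.
Hypothesis B_linr : forall x a y z, B x (a *: y + z) = a * B x y + B x z.
Hypothesis B_nondeg :
  forall x, x \in U -> (forall y, y \in U -> B y x = 0) -> x = 0.

Let pairing_fun (H x : subvs_of U) : K^o := B (vsval x) (vsval H).

Lemma pairing_fun_linear H : linear (pairing_fun H).
Proof. by move=> a x y; rewrite /pairing_fun linearP B_linl. Qed.

HB.instance Definition _ H := GRing.isSemilinear.Build K _ _ _ (pairing_fun H)
  (GRing.semilinear_linear (pairing_fun_linear H)).

Let pairing H : 'Hom(subvs_of U, K^o) := linfun (pairing_fun H).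

Lemma pairing_linear : linear pairing.
Proof.
move=> a x y; apply/lfunP => z; rewrite !lfunE /= !lfunE /=.
by rewrite /pairing_fun linearP B_linr lfunE.
Qed.

HB.instance Definition _ := GRing.isSemilinear.Build K _ _ _ pairing
  (GRing.semilinear_linear pairing_linear).

(** Nondegeneracy makes the map from [U] to its dual injective, and the dimensions agree. It serves
    both [h] and the centralizer [h']. *)
Lemma representable (phi : 'Hom(subvs_of U, K^o)) :
  exists2 H, H \in U & forall x, x \in U -> B x H = phi (vsproj U x).
Proof.
pose T : 'Hom(subvs_of U, 'Hom(subvs_of U, K^o)) := linfun pairing.
have kT : lker T = 0%VS.
  apply/eqP; rewrite -subv0; apply/subvP => H; rewrite memv_ker memv0 lfunE /=.
  move=> /eqP H0; apply/eqP/val_inj => /=; apply: B_nondeg; first exact: subvsP.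
  move=> y yU; move/lfunP/(_ (vsproj U y)): H0.
  by rewrite !lfunE /= /pairing_fun vsprojK.
have limT : limg T = fullv.
  apply/eqP; rewrite eqEdim subvf /= limg_dim_eq ?kT ?capv0 //.
  by rewrite !dimvf /dim /= muln1.
have : phi \in limg T by rewrite limT memvf.
case/memv_imgP => H _ ->; exists (vsval H); first exact: subvsP.
by move=> x xU; rewrite !lfunE /= /pairing_fun vsprojK.
Qed.

End Represent.

(** * Weights of a toral subalgebra *)

Section Weights.
Variables (K : fieldType) (g : lieAlgType K) (h : {vspace g}).
Implicit Types (x y z : g) (beta gamma : dual h).

Lemma eval_dualP beta a x y :
  eval_dual beta (a *: x + y) = a * eval_dual beta x + eval_dual beta y.
Proof. by rewrite /eval_dual !linearP. Qed.

Lemma eval_dualZ beta a x : eval_dual beta (a *: x) = a * eval_dual beta x.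
Proof. by rewrite /eval_dual !linearZ. Qed.

Lemma eval_dualDr beta x y :
  eval_dual beta (x + y) = eval_dual beta x + eval_dual beta y.
Proof. by rewrite /eval_dual !linearD. Qed.

Lemma eval_dualD beta gamma x :
  eval_dual (beta + gamma) x = eval_dual beta x + eval_dual gamma x.
Proof. by rewrite /eval_dual add_lfunE. Qed.

Lemma eval_dualN beta x : eval_dual (- beta) x = - eval_dual beta x.
Proof. by rewrite /eval_dual opp_lfunE. Qed.

Lemma eval_dual0l x : eval_dual (0 : dual h) x = 0.
Proof. by rewrite /eval_dual zero_lfunE. Qed.

Lemma eval_dual_sum (I : Type) (r : seq I) (P : pred I) (F : I -> dual h) x :
  eval_dual (\sum_(i <- r | P i) F i) x = \sum_(i <- r | P i) eval_dual (F i) x.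
Proof. by rewrite /eval_dual sum_lfunE. Qed.

Lemma dual_ext beta gamma :
  (forall x, x \in h -> eval_dual beta x = eval_dual gamma x) -> beta = gamma.
Proof.
move=> eq_bg; apply/lfunP => u.
by have := eq_bg _ (subvsP u); rewrite /eval_dual vsvalK.
Qed.

Lemma dual_of_fun (f : g -> K) : (forall a x y, f (a *: x + y) = a * f x + f y) ->
  exists beta, forall x, x \in h -> eval_dual beta x = f x.
Proof.
move=> f_lin; pose F (u : subvs_of h) : K^o := f (vsval u).
have F_lin : linear F by move=> a u v; rewrite /F linearP f_lin.
pose F' : {linear subvs_of h -> K^o} :=
  HB.pack F (GRing.isSemilinear.Build K _ _ _ F (GRing.semilinear_linear F_lin)).
exists (linfun F') => x xh; rewrite /eval_dual lfunE /=.
by rewrite /F vsprojK.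
Qed.

Lemma in_root_spaceZ gamma a x :
  in_root_space gamma x -> in_root_space gamma (a *: x).
Proof. by move=> gx z zh; rewrite linearZ /= gx // !scalerA mulrC. Qed.

Lemma in_root_space_lie beta gamma x y : in_root_space beta x ->
  in_root_space gamma y -> in_root_space (beta + gamma) (lie x y).
Proof.
move=> bx gy z zh; rewrite lie_lie (bx z zh) (gy z zh) lieZl linearZ /=.
by rewrite -scalerDl eval_dualD.
Qed.

(** The operators [ad x] for [x] in a basis of [h] commute and are diagonalizable, hence are
    simultaneously diagonalizable; linearity extends this to all of [h]. *)
Lemma weight_basis : is_abelian h ->
  (forall x, x \in h -> diagonalizable (mx_of_end (ad x))) ->
  exists (b : (\dim {:g}).-tuple g) (w : 'I_(\dim {:g}) -> dual h),
    basis_of {:g} b /\ forall i, in_root_space (w i) b`_i.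
Proof.
move=> h_ab h_diag; set n := \dim {:g}; set v := vbasis {:g}.
have vb : basis_of {:g} v by apply: vbasisP.
pose As := [seq mx_of_end (ad x) | x <- vbasis h].
have [|P Pu /allP Pdiag] := (codiagonalizableP As).1.
  split=> [_ _ /mapP[x xh ->] /mapP[y yh ->]|_ /mapP[x xh ->]]; last first.
    by apply: h_diag; apply: vbasis_mem.
  rewrite /comm_mx /mx_of_end -!(passmx.mxof_comp _ _ vb); congr passmx.mxof.
  apply/lfunP => z; rewrite !comp_lfunE !adE [RHS]lie_lie.
  by rewrite (h_ab x y) ?vbasis_mem // lie0l add0r.
pose b := [tuple passmx.vecof v (row i P) | i < n].
have bE (i : 'I_n) : b`_i = passmx.vecof v (row i P).
  by rewrite -tnth_nth tnth_mktuple.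
have bb : basis_of {:g} b.
  rewrite basisEdim size_tuple leqnn andbT; apply/subvP => x _.
  rewrite -(passmx.rVofK vb x) -[passmx.rVof v x](mulmxKV Pu).
  set u := _ *m invmx P; rewrite mulmx_sum_row linear_sum.
  apply: memv_suml => i _; rewrite linearZ /= -bE rpredZ // memv_span //.
  by rewrite mem_nth // size_tuple.
have eigen (x : g) : x \in h -> forall i : 'I_n, lie x b`_i = coord b i (lie x b`_i) *: b`_i.
  move=> xh i; rewrite [x in LHS](coord_vbasis xh) [x in RHS](coord_vbasis xh).
  rewrite !lie_suml linear_sum scaler_suml; apply: eq_bigr => j _.
  rewrite lieZl linearZ /= -scalerA; congr (_ *: _).
  have jh : (vbasis h)`_j \in vbasis h by rewrite mem_nth // size_tuple.
  have /= := Pdiag _ (map_f (fun x => mx_of_end (ad x)) jh).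
  case/diagonalizable_forPex => D /(simmxP Pu) PD.
  suff -> : lie (vbasis h)`_j b`_i = D 0 i *: b`_i.
    by rewrite linearZ /= coord_free ?(basis_free bb) // eqxx mulr1.
  rewrite -adE bE (hom_vecof _ vb) -row_mul.
  have -> : P *m passmx.mxof v v (ad (vbasis h)`_j) = diag_mx D *m P by exact: PD.
  by rewrite row_mul row_diag_mx -scalemxAl -rowE linearZ.
(* Reading the eigenvalue as the i-th coordinate of the bracket with the i-th basis vector makes it
   visibly linear in [x], so that it is an element of [dual h]. *)
have [|w wP] := @boolp.choice _ _ (fun (i : 'I_n) (beta : dual h) =>
    forall x, x \in h -> eval_dual beta x = coord b i (lie x b`_i)).
  move=> i; apply: dual_of_fun => a x y; rewrite lieDl lieZl linearP //.
by exists b, w; split=> // i x xh; rewrite wP //; apply: eigen.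
Qed.

Variables (b : (\dim {:g}).-tuple g) (w : 'I_(\dim {:g}) -> dual h).
Hypotheses (b_basis : basis_of {:g} b) (b_weight : forall i, in_root_space (w i) b`_i).

Lemma basis_expand x : x = \sum_i coord b i x *: b`_i.
Proof. exact: (coord_basis b_basis (memvf x)). Qed.

Lemma coord_basisE (i j : 'I_(\dim {:g})) : coord b i b`_j = (i == j)%:R.
Proof. by rewrite coord_free ?(basis_free b_basis) // eq_sym. Qed.

Lemma basis_elt_neq0 (i : 'I_(\dim {:g})) : b`_i <> 0.
Proof.
move=> b0; have := coord_basisE i i; rewrite b0 linear0 eqxx => /eqP.
by rewrite eq_sym oner_eq0.
Qed.

Lemma basis_ext x y : (forall i, coord b i x = coord b i y) -> x = y.
Proof.
move=> eq_xy; rewrite (basis_expand x) (basis_expand y).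
by apply: eq_bigr => i _; rewrite eq_xy.
Qed.

Lemma coord_weight gamma z i : in_root_space gamma z -> coord b i z != 0 -> w i = gamma.
Proof.
move=> gz zi; apply: dual_ext => x xh; apply: (mulIf zi).
have := gz x xh; rewrite {1}[z]basis_expand linear_sum /= => /(congr1 (coord b i)).
rewrite linear_sum linearZ /= => <-; rewrite (bigD1 i) //= big1 ?addr0 => [|j ji].
  by rewrite linearZ /= b_weight // !linearZ /= coord_basisE eqxx mulr1 mulrC.
rewrite linearZ /= b_weight // !linearZ /= coord_basisE eq_sym (negPf ji).
by rewrite !mulr0.
Qed.

Lemma in_root_space_eq0 gamma z :
  in_root_space gamma z -> (forall i, w i <> gamma) -> z = 0.
Proof.
move=> gz wg; apply: basis_ext => i; rewrite linear0.
by apply/eqP/negP => /negP /(coord_weight gz) /wg.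
Qed.

Lemma root_weight beta : is_root beta -> exists i, w i = beta.
Proof.
case=> _ [x x0 bx].
have [i xi] : exists i, coord b i x != 0.
  apply/existsP; apply/contraT; rewrite negb_exists => /forallP x0'.
  by case: x0; apply: basis_ext => i; rewrite linear0; apply/eqP; rewrite -[_ == _]negbK.
by exists i; apply: coord_weight xi.
Qed.

Lemma weight_root i : w i <> 0 -> is_root (w i).
Proof. by move=> wi; split=> //; exists b`_i => //; apply: basis_elt_neq0. Qed.

Lemma not_root_eq0 gamma z :
  in_root_space gamma z -> gamma <> 0 -> ~ is_root gamma -> z = 0.
Proof.
move=> gz g0 ngr; apply: (in_root_space_eq0 gz) => i wi.
by apply: ngr; rewrite -wi; apply: weight_root; rewrite wi.
Qed.

(** Scalar [f gamma] on the whole weight space of [gamma]. For an indicator [f] it is the projection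
    onto a sum of weight spaces: traces against it are partial traces, and the projections of the
    grading are of this form. *)
Definition weight_op (f : dual h -> K) : 'End(g) :=
  linfun (fun z => \sum_i (f (w i) * coord b i z) *: b`_i).

Let weight_fun (f : dual h -> K) z := \sum_i (f (w i) * coord b i z) *: b`_i.

Lemma weight_opE f z : weight_op f z = \sum_i (f (w i) * coord b i z) *: b`_i.
Proof.
have W_lin : linear (weight_fun f).
  move=> a x y; rewrite /weight_fun scaler_sumr -big_split; apply: eq_bigr => i _ /=.
  by rewrite linearP /= mulrDr scalerDl scalerA mulrCA.
pose F' : {linear g -> g} := HB.pack (weight_fun f)
  (GRing.isSemilinear.Build K _ _ _ (weight_fun f) (GRing.semilinear_linear W_lin)).
by rewrite -[weight_op f]/(linfun F') lfunE.
Qed.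

Lemma weight_op_weight f gamma z :
  in_root_space gamma z -> weight_op f z = f gamma *: z.
Proof.
move=> gz; rewrite weight_opE [z in RHS]basis_expand scaler_sumr.
apply: eq_bigr => i _; rewrite scalerA.
case: (eqVneq (coord b i z) 0) => [->|zi]; first by rewrite !mulr0.
by rewrite (coord_weight gz zi).
Qed.

Lemma tr_weight_op (f : dual h -> K) (phi : 'End(g)) :
  tr_end (weight_op f \o phi)%VF = \sum_i f (w i) * coord b i (phi b`_i).
Proof.
rewrite (tr_endE _ b_basis); apply: eq_bigr => i _; rewrite comp_lfunE weight_opE.
rewrite linear_sum (bigD1 i) //= big1 => [|j ji]; rewrite linearZ /= coord_basisE.
  by rewrite eqxx mulr1 addr0.
by rewrite eq_sym (negPf ji) mulr0.
Qed.

Lemma killing_weight x y : x \in h -> y \in h ->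
  killing x y = \sum_i eval_dual (w i) x * eval_dual (w i) y.
Proof.
move=> xh yh; rewrite /killing -/(tr_end _) (tr_endE _ b_basis).
apply: eq_bigr => i _; rewrite comp_lfunE !adE b_weight // linearZ /= b_weight //.
by rewrite !linearZ /= coord_basisE eqxx mulr1 mulrC.
Qed.

(* The trace of [weight_op f \o ad [x, y]], computed on one side from the
   eigenvalues and on the other from the cyclicity of the trace. *)
Lemma weight_trace alpha x y (f : dual h -> K) : lie x y \in h ->
  in_root_space alpha x -> in_root_space (- alpha) y ->
  \sum_i f (w i) * eval_dual (w i) (lie x y) =
  \sum_i (f (w i) - f (w i - alpha)) * coord b i (lie x (lie y b`_i)).
Proof.
move=> xyh ax ay; transitivity (tr_end (weight_op f \o ad (lie x y))%VF).
  rewrite tr_weight_op; apply: eq_bigr => i _.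
  by rewrite adE b_weight // linearZ /= coord_basisE eqxx mulr1.
have -> : (weight_op f \o ad (lie x y))%VF =
  -1 *: ((weight_op f \o ad y) \o ad x)%VF + (weight_op f \o (ad x \o ad y))%VF.
  by rewrite ad_lie comp_lfunDr comp_lfunNr scaleN1r addrC (comp_lfunA _ (ad y)).
rewrite tr_end_linear mulN1r addrC tr_weight_op tr_endC (tr_endE _ b_basis).
rewrite -sumrB; apply: eq_bigr => i _; rewrite !comp_lfunE !adE mulrBl.
(* After cycling, [weight_op f] meets the bracket of [y] with the i-th basis vector, of weight
   [w i - alpha]: this is the origin of the shifted argument. *)
congr (_ - _); rewrite (weight_op_weight f (gamma := w i - alpha)) ?linearZ //.
by rewrite addrC; apply: in_root_space_lie.
Qed.

End Weights.

(** * Invariant forms and root spaces *)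

Section Form.
Variables (K : fieldType) (g : lieAlgType K) (c : K) (B : g -> g -> K).
Hypothesis B_killing : forall x y, B x y = c * killing x y.
Implicit Types (x y z : g).

Lemma formC x y : B x y = B y x.
Proof. by rewrite !B_killing killingC. Qed.

Lemma form_linl z a x y : B (a *: x + y) z = a * B x z + B y z.
Proof. by rewrite !B_killing killing_linearl mulrDr mulrCA. Qed.

Lemma form_linr z a x y : B z (a *: x + y) = a * B z x + B z y.
Proof. by rewrite formC form_linl !(formC z). Qed.

Lemma form0l x : B 0 x = 0.
Proof.
have := form_linl x 1 0 0; rewrite scale1r addr0 mul1r => E.
by apply: (addrI (B 0 x)); rewrite addr0 -E.
Qed.

Lemma formDl x y z : B (x + y) z = B x z + B y z.
Proof. by have := form_linl z 1 x y; rewrite scale1r mul1r. Qed.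

Lemma formZl a x z : B (a *: x) z = a * B x z.
Proof. by have := form_linl z a x 0; rewrite !addr0 form0l addr0. Qed.

Lemma formNl x z : B (- x) z = - B x z.
Proof. by rewrite -scaleN1r formZl mulN1r. Qed.

Lemma form0r x : B x 0 = 0.
Proof. by rewrite formC form0l. Qed.

Lemma formDr x y z : B z (x + y) = B z x + B z y.
Proof. by rewrite formC formDl !(formC z). Qed.

Lemma formZr a x z : B z (a *: x) = a * B z x.
Proof. by rewrite formC formZl (formC z). Qed.

Lemma formNr x z : B z (- x) = - B z x.
Proof. by rewrite formC formNl (formC z). Qed.

Lemma form_suml (I : Type) (r : seq I) (P : pred I) (F : I -> g) z :
  B (\sum_(i <- r | P i) F i) z = \sum_(i <- r | P i) B (F i) z.
Proof. by elim/big_rec2: _ => [|i y1 y2 _ <-]; rewrite ?form0l ?formDl. Qed.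

Lemma form_sumr (I : Type) (r : seq I) (P : pred I) (F : I -> g) z :
  B z (\sum_(i <- r | P i) F i) = \sum_(i <- r | P i) B z (F i).
Proof. by rewrite formC form_suml; apply: eq_bigr => i _; rewrite formC. Qed.

Lemma form_lie x y z : B (lie x y) z = B x (lie y z).
Proof. by rewrite !B_killing killing_lie. Qed.

(* The radical of [B] is an ideal. *)
Lemma simple_form_nondeg : is_simple g -> (exists x y, B x y <> 0) ->
  forall x, (forall y, B y x = 0) -> x = 0.
Proof.
move=> [_ g_simple] [x0 [y0 B0]] x Bx.
have F_lin (z : g) : linear (fun y : g => B z y : K^o).
  by move=> a y1 y2; rewrite form_linr.
pose F z : {linear g -> K^o} := HB.pack (fun y : g => B z y : K^o)
  (GRing.isSemilinear.Build K _ _ _ _ (GRing.semilinear_linear (F_lin z))).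
pose G z : 'Hom(g, K^o) := linfun (F z).
have G_lin : linear G.
  move=> a y1 y2; apply/lfunP => z; rewrite add_lfunE scale_lfunE !lfunE /=.
  exact: form_linl.
pose G' : {linear g -> 'Hom(g, K^o)} := HB.pack G
  (GRing.isSemilinear.Build K _ _ _ _ (GRing.semilinear_linear G_lin)).
have inI z : z \in lker (linfun G') -> forall y, B z y = 0.
  rewrite memv_ker lfunE /= => /eqP Gz y.
  by have := congr1 (fun f : 'Hom(g, K^o) => f y) Gz; rewrite zero_lfunE lfunE.
have Iin z : (forall y, B z y = 0) -> z \in lker (linfun G').
  move=> zy; rewrite memv_ker lfunE /=; apply/eqP/lfunP => y.
  by rewrite zero_lfunE lfunE /= zy.
case: (g_simple (lker (linfun G'))) => [y z zI|I0|I1].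
- by apply: Iin => u; rewrite lieC formNl form_lie inI ?oppr0.
- have : x \in lker (linfun G') by apply: Iin => y; rewrite formC.
  by rewrite I0 memv0 => /eqP.
- by case: B0; apply: inI; rewrite I1 memvf.
Qed.

End Form.

(** * Roots: strings, positivity, multiplicity one *)

Section RootSpaces.
Variables (C : numClosedFieldType) (g : lieAlgType C) (h : {vspace g}).
Variables (c : C) (B : g -> g -> C).
Variables (b : (\dim {:g}).-tuple g) (w : 'I_(\dim {:g}) -> dual h).
Hypotheses (b_basis : basis_of {:g} b) (b_weight : forall i, in_root_space (w i) b`_i).
Hypotheses (B_killing : forall x y, B x y = c * killing x y) (c_gt0 : 0 < c).
Hypothesis B_nondeg : forall x, (forall y, B y x = 0) -> x = 0.
Hypothesis h_self : forall x : g, in_root_space (0 : dual h) x <-> x \in h.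
Implicit Types (x y z : g) (alpha beta gamma delta : dual h).

Let BC := formC B_killing.
Let BZl := formZl B_killing.
Let BZr := formZr B_killing.
Let Blie := form_lie B_killing.

(** Invariance gives [(alpha + beta)(z) * B x y = 0] for every [z] in [h]. *)
Lemma form_orth alpha beta x y : in_root_space alpha x -> in_root_space beta y ->
  alpha + beta <> 0 -> B x y = 0.
Proof.
move=> ax bly ab0; apply/eqP/negP => /negP Bxy; case: ab0.
apply: dual_ext => z zh; apply: (mulIf Bxy); rewrite eval_dualD eval_dual0l mul0r mulrDl.
by rewrite -!BZl -ax // lieC (formNl B_killing) Blie bly // BZr BZl addNr.
Qed.

Lemma form_orth_cartan alpha x y : x \in h -> in_root_space alpha y ->
  alpha <> 0 -> B x y = 0.
Proof. by move=> /h_self x0 ay a0; apply: (form_orth x0 ay); rewrite add0r. Qed.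

(** Weight vectors of nonzero weight are orthogonal to [h], and those of weight 0 lie in [h], so a
    vector orthogonal to [h] within [h] is orthogonal to all of [g]. *)
Lemma form_cartan_nondeg x : x \in h -> (forall y, y \in h -> B y x = 0) -> x = 0.
Proof.
move=> xh Bx; apply: B_nondeg => y; rewrite (basis_expand b_basis y).
rewrite (form_suml B_killing) big1 // => i _; rewrite BZl.
case: (eqVneq (w i) 0) => [wi|/eqP wi]; last first.
  by rewrite BC (form_orth_cartan xh (b_weight i) wi) mulr0.
by rewrite Bx ?mulr0 //; apply/h_self; rewrite -wi.
Qed.

Lemma dual_vector_exists (beta : dual h) : exists H, is_dual_vector B beta H.
Proof.
have [H Hh HP] := representable (form_linl B_killing) (form_linr B_killing)
  form_cartan_nondeg beta.
by exists H; split.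
Qed.

Lemma dual_vector_uniq beta H H' :
  is_dual_vector B beta H -> is_dual_vector B beta H' -> H = H'.
Proof.
move=> [Hh HP] [Hh' HP']; apply/eqP; rewrite -subr_eq0; apply/eqP.
apply: form_cartan_nondeg => [|y yh]; first exact: rpredB.
by rewrite (formDr B_killing) (formNr B_killing) HP // HP' // subrr.
Qed.

Variable t : dual h -> g.
Hypothesis t_dual : forall beta, is_dual_vector B beta (t beta).

Lemma t_cartan beta : t beta \in h. Proof. by case: (t_dual beta). Qed.

Lemma form_t beta x : x \in h -> B x (t beta) = eval_dual beta x.
Proof. by case: (t_dual beta) => _; apply. Qed.

Lemma t_linear a beta gamma : t (a *: beta + gamma) = a *: t beta + t gamma.
Proof.
apply: (dual_vector_uniq (t_dual _)); split.
  by rewrite rpredD ?rpredZ ?t_cartan.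
move=> x xh; rewrite (form_linr B_killing) !form_t //.
by rewrite /eval_dual add_lfunE scale_lfunE.
Qed.

(** Some basis vector pairs nontrivially with [x], and by [form_orth] its weight can only be
    [- alpha]. *)
Lemma opp_rootE alpha x : alpha <> 0 -> in_root_space alpha x -> x <> 0 ->
  exists2 y, in_root_space (- alpha) y & B x y = 1.
Proof.
move=> a0 ax x0.
have [i Bi] : exists i : 'I_(\dim {:g}), B x b`_i != 0.
  apply/existsP; apply/contraT; rewrite negb_exists => /forallP Bx.
  case: x0; apply: B_nondeg => y; rewrite BC (basis_expand b_basis y).
  rewrite (form_sumr B_killing) big1 // => i _; rewrite BZr.
  by have := Bx i; rewrite negbK => /eqP ->; rewrite mulr0.
have wi : w i = - alpha.
  apply/eqP; rewrite -addr_eq0 addrC; apply/negP => /negP /eqP wi.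
  by rewrite (form_orth ax (b_weight i) wi) eqxx in Bi.
exists ((B x b`_i)^-1 *: b`_i); last by rewrite BZr mulVf.
by apply: in_root_spaceZ; rewrite -wi.
Qed.

Lemma opp_root alpha : is_root alpha -> is_root (- alpha).
Proof.
move=> [a0 [x x0 ax]]; have [y ay xy] := opp_rootE a0 ax x0.
split; first by move/eqP; rewrite oppr_eq0 => /eqP.
by exists y => // y0; move/eqP: xy; rewrite y0 (form0r B_killing) eq_sym oner_eq0.
Qed.

(** Both sides have weight 0, so lie in [h], and invariance shows that they pair equally with every
    element of [h]. *)
Lemma lie_opp alpha x y : in_root_space alpha x -> in_root_space (- alpha) y ->
  lie x y = B x y *: t alpha.
Proof.
move=> ax ay; apply/eqP; rewrite -subr_eq0; apply/eqP.
have xyh : lie x y \in h.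
  by apply/h_self; rewrite -(subrr alpha); apply: in_root_space_lie.
apply: form_cartan_nondeg => [|z zh]; first by rewrite rpredB ?rpredZ ?t_cartan.
rewrite (formDr B_killing) (formNr B_killing) BZr form_t //.
by rewrite -Blie ax // BZl mulrC subrr.
Qed.

Lemma scalar_dual_inj alpha (m n : int) : alpha <> 0 -> alpha *~ m = alpha *~ n -> m = n.
Proof.
move=> /eqP a0 /eqP; rewrite -subr_eq0 -mulrzBr -scaler_int scaler_eq0 (negPf a0).
by rewrite orbF intr_eq0 subr_eq0 => /eqP.
Qed.

Lemma root_vector_pair alpha : is_root alpha -> exists x y,
  [/\ in_root_space alpha x, in_root_space (- alpha) y & B x y = 1].
Proof.
by move=> [a0 [x x0 ax]]; have [y ay xy] := opp_rootE a0 ax x0; exists x, y.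
Qed.

Lemma eval_dualMz alpha (k : int) x : eval_dual (alpha *~ k) x = k%:~R * eval_dual alpha x.
Proof. by rewrite -scaler_int /eval_dual scale_lfunE. Qed.

(** Position of the i-th weight on the line [beta + Z alpha], [None] off the line. It is indexed by
    basis vectors, not by weights, so sums over it count multiplicities. *)
Definition string alpha beta : 'I_(\dim {:g}) -> option int := fun i =>
  match boolp.pselect (exists k : int, w i = beta + alpha *~ k) with
  | left e => Some (projT1 (boolp.cid e))
  | right _ => None
  end.

Lemma stringP alpha beta i k : string alpha beta i = Some k -> w i = beta + alpha *~ k.
Proof.
by rewrite /string; case: boolp.pselect => // e [<-]; case: boolp.cid.
Qed.

Lemma stringPn alpha beta i : string alpha beta i = None ->
  forall k : int, w i <> beta + alpha *~ k.
Proof. by rewrite /string; case: boolp.pselect => // ne _ k wi; case: ne; exists k. Qed.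

(* [f] is the indicator of the string [beta + Z alpha], on which [ad t_alpha],
   being a commutator, has trace 0. *)
Lemma string_sum alpha beta : is_root alpha ->
  \sum_i (if string alpha beta i is Some k
          then eval_dual beta (t alpha) + k%:~R * eval_dual alpha (t alpha) else 0) = 0.
Proof.
move=> /root_vector_pair[x [y [ax ay xy1]]].
pose f gamma : C := (boolp.asbool (exists k : int, gamma = beta + alpha *~ k))%:R.
have xyE := lie_opp ax ay; rewrite xy1 scale1r in xyE.
have := weight_trace b_basis b_weight f (x := x) (y := y) (alpha := alpha).
rewrite xyE t_cartan => /(_ isT ax ay).
rewrite [RHS]big1 => [E0|i _]; last first.
  suff -> : f (w i - alpha) = f (w i) by rewrite subrr mul0r.
  congr (_%:R); congr (nat_of_bool _); apply: boolp.asbool_equiv_eq; split=> -[k].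
    by move=> /(canRL (subrK _)) ->; exists (k + 1); rewrite mulrzDr addrA.
  by move=> ->; exists (k - 1); rewrite mulrzBr addrA.
rewrite -[RHS]E0; apply: eq_bigr => i _; case E: (string _ _ _) => [k|]; rewrite /f.
  rewrite boolp.asboolT ?mul1r; last by exists k; apply: stringP.
  by rewrite (stringP E) eval_dualD eval_dualMz.
rewrite boolp.asboolF ?mul0r // => -[k]; exact: (stringPn E).
Qed.

(** [string_sum] reads [M * beta (t alpha) + K * alpha (t alpha) = 0], with [M] the number of basis
    vectors on the string and [K] the sum of their integer positions. [M] is positive because [beta]
    itself is at position 0, so [rho = - K / M]. *)
Lemma root_string_real alpha beta : is_root alpha -> is_root beta ->
  exists2 rho, rho \is Num.real & eval_dual beta (t alpha) = rho * eval_dual alpha (t alpha).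
Proof.
move=> ra rb; have := string_sum beta ra.
set F := BIG_F.
pose m i : nat := string alpha beta i != None.
pose k i : int := odflt 0 (string alpha beta i).
have -> : \sum_i F i = (\sum_i m i)%N%:R * eval_dual beta (t alpha) +
    (\sum_i k i)%:~R * eval_dual alpha (t alpha).
  rewrite natr_sum mulr_suml rmorph_sum mulr_suml -big_split; apply: eq_bigr => i _ /=.
  by rewrite /F /m /k; case: string => [j|] /=; rewrite ?mul1r // !mul0r addr0.
move/eqP; rewrite addr_eq0 => /eqP sum0.
have m_gt0 : ((\sum_i m i)%N%:R : C) != 0.
  have [i wi] := root_weight b_basis b_weight rb.
  rewrite pnatr_eq0 (bigD1 i) //= /m; case E: string => [//|].
  by case: (stringPn E (k := 0)); rewrite mulr0z addr0.
exists (- (\sum_i k i)%:~R / (\sum_i m i)%N%:R).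
  by rewrite realM ?realN ?realV ?realz ?realn.
by apply: (mulfI m_gt0); rewrite sum0 mulrA mulrCA mulfV // mulr1 mulNr.
Qed.

Lemma form_tt beta gamma : B (t beta) (t gamma) =
  c * \sum_i eval_dual (w i) (t beta) * eval_dual (w i) (t gamma).
Proof. by rewrite B_killing (killing_weight b_basis b_weight) ?t_cartan. Qed.

(** With [a = alpha (t alpha)], every weight takes at [t alpha] a real multiple [rho i * a], so the
    trace formula for the Killing form gives [a = c * (sum of rho i ^+ 2) * a ^+ 2]. If [a] were 0,
    all weights would vanish at [t alpha], forcing [alpha = 0]; hence [a] is the inverse of a
    positive number. *)
Lemma root_norm_gt0 alpha : is_root alpha -> 0 < eval_dual alpha (t alpha).
Proof.
move=> ra; set a := eval_dual _ _.
have [rho rhoP] : exists rho : 'I_(\dim {:g}) -> C,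
    forall i, rho i \is Num.real /\ eval_dual (w i) (t alpha) = rho i * a.
  suff /boolp.choice[rho rhoP] : forall i : 'I_(\dim {:g}), exists r : C,
    r \is Num.real /\ eval_dual (w i) (t alpha) = r * a by exists rho.
  move=> i; case: (boolp.pselect (w i = 0)) => [wi|/(weight_root b_basis b_weight) wi].
    by exists 0; rewrite wi eval_dual0l mul0r real0.
  by have [r rr rE] := root_string_real ra wi; exists r.
have aE : a = c * (\sum_i rho i ^+ 2) * a ^+ 2.
  rewrite {1}/a -form_t ?t_cartan // form_tt -mulrA mulr_suml; congr (_ * _).
  apply: eq_bigr => i _; by have [_ ->] := rhoP i; rewrite mulrACA -!expr2.
have a0 : a != 0.
  apply/eqP => a0; have [a1 _] := ra; case: a1.
  have t0 : t alpha = 0.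
    apply: form_cartan_nondeg => [|y yh]; first exact: t_cartan.
    rewrite B_killing (killing_weight b_basis b_weight) ?t_cartan // big1 ?mulr0 // => i _.
    by have [_ ->] := rhoP i; rewrite a0 !mulr0.
  by apply: dual_ext => x xh; rewrite -form_t // t0 (form0r B_killing) eval_dual0l.
have s0 : 0 <= c * \sum_i rho i ^+ 2.
  rewrite mulr_ge0 ?(ltW c_gt0) // sumr_ge0 // => i _.
  by rewrite real_exprn_even_ge0 //; case: (rhoP i).
have E1 : c * (\sum_i rho i ^+ 2) * a = 1.
  by apply: (mulIf a0); rewrite mul1r [RHS]aE expr2 mulrA.
have -> : a = (c * \sum_i rho i ^+ 2)^-1.
  have s1 : c * (\sum_i rho i ^+ 2) != 0.
    by apply/eqP => s1; move/eqP: E1; rewrite s1 mul0r eq_sym oner_eq0.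
  by apply: (mulfI s1); rewrite E1 mulfV.
rewrite invr_gt0 lt_def s0 andbT; apply/eqP => s1.
by move/eqP: E1; rewrite s1 mul0r eq_sym oner_eq0.
Qed.

Lemma root_eval_real alpha beta : is_root alpha -> is_root beta ->
  eval_dual beta (t alpha) \is Num.real.
Proof.
move=> ra rb; have [rho rr ->] := root_string_real ra rb.
by rewrite realM // gtr0_real // root_norm_gt0.
Qed.

(* Here [f] is the indicator of the positive multiples of [alpha]. *)
Lemma root_mult1 alpha i j : is_root alpha -> w i = alpha -> w j = alpha -> i = j.
Proof.
move=> ra wi wj; have [x [y [ax ay xy1]]] := root_vector_pair ra.
have [a0 _] := ra; have apos := root_norm_gt0 ra.
set a := eval_dual alpha (t alpha) in apos.
pose f gamma : C := (boolp.asbool (exists k : nat, gamma = alpha *~ k.+1))%:R.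
have xyE := lie_opp ax ay; rewrite xy1 scale1r in xyE.
have := weight_trace b_basis b_weight f (x := x) (y := y) (alpha := alpha).
rewrite xyE t_cartan => /(_ isT ax ay).
(* A translation by [alpha] enters the positive multiples of [alpha] only at [w i = alpha]; by
   [lie_opp] these terms add up to [B x y * a]. *)
have -> : \sum_i (f (w i) - f (w i - alpha)) * coord b i (lie x (lie y b`_i)) = a.
  transitivity (\sum_i coord b i x * B b`_i y * a).
    apply: eq_bigr => k _; case: (eqVneq (w k) alpha) => [wk|/eqP wk].
      rewrite wk subrr /f boolp.asboolT; last by exists 0%N; rewrite mulr1z.
      rewrite boolp.asboolF => [|[k' /esym E]]; last first.
        by have := scalar_dual_inj (m := k'.+1) (n := 0) a0; rewrite E mulr0z => /(_ erefl)/eqP.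
      rewrite subr0 mul1r (lieC y) linearN /= (lie_opp (x := b`_k) (y := y) (alpha := alpha)) //; last by rewrite -wk.
      by rewrite linearZ /= -scalerN -lieC ax ?t_cartan // !linearZ /= -/a mulrCA mulrC (mulrC (B _ _)).
    have -> : f (w k - alpha) = f (w k).
      congr (_%:R); congr (nat_of_bool _); apply: boolp.asbool_equiv_eq; split=> -[n].
        move=> /(canRL (subrK _)) ->; exists n.+1.
        by rewrite -[in RHS]addn1 PoszD mulrzDr mulr1z.
      case: n => [|n] E; first by case: wk; rewrite E mulr1z.
      exists n; rewrite E -[in LHS]addn1 PoszD mulrzDr mulr1z addrK //.
    rewrite subrr mul0r.
    case: (eqVneq (coord b k x) 0) => [->|/(coord_weight b_basis b_weight ax)//].
    by rewrite !mul0r.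
  rewrite -mulr_suml -[RHS]mul1r -xy1; congr (_ * _).
  rewrite [x in RHS](basis_expand b_basis) (form_suml B_killing).
  by apply: eq_bigr => k _; rewrite BZl.
(* The other side of the trace identity is [a] times the sum of [n] over the basis vectors of weight
   [n alpha], [n > 0]. That sum is therefore 1, which two vectors of weight [alpha] would exceed. *)
have [m mP] : exists m : 'I_(\dim {:g}) -> nat, forall k,
    f (w k) * eval_dual (w k) (t alpha) = (m k)%:R * a /\ (w k = alpha -> m k = 1%N).
  suff /boolp.choice[m mP] : forall k : 'I_(\dim {:g}), exists n : nat,
    f (w k) * eval_dual (w k) (t alpha) = n%:R * a /\ (w k = alpha -> n = 1%N).
    by exists m.
  move=> k; rewrite /f; case: boolp.asboolP => [[n wk]|nk].
    exists n.+1; rewrite mul1r wk eval_dualMz; split=> //.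
    by rewrite -[RHS]mulr1z => /(scalar_dual_inj a0) [->].
  by exists 0%N; rewrite !mul0r; split=> // wk; case: nk; exists 0%N; rewrite mulr1z.
rewrite (eq_bigr (fun k => (m k)%:R * a)) => [|k _]; last by case: (mP k).
rewrite -mulr_suml -[RHS]mul1r => /(mulIf (lt0r_neq0 apos)) /eqP.
rewrite -natr_sum pnatr_eq1 => /eqP sum1.
apply/eqP/negP => /negP ij; move: sum1; rewrite (bigD1 i) //= (bigD1 j) 1?eq_sym //=.
by have [_ ->] := mP i; rewrite // (mP j).2 // !addnA addn1 !addSn.
Qed.

Lemma root_space_line alpha x y z : is_root alpha -> in_root_space alpha x ->
  in_root_space (- alpha) y -> B x y = 1 -> in_root_space alpha z -> z = B z y *: x.
Proof.
move=> ra ax ay xy1 az; have [i wi] := root_weight b_basis b_weight ra.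
have E v : in_root_space alpha v -> v = coord b i v *: b`_i.
  move=> av; apply: (basis_ext b_basis) => k; rewrite linearZ /= (coord_basisE b_basis).
  case: (eqVneq k i) => [->|ki]; first by rewrite mulr1.
  rewrite mulr0; apply/eqP/negP => /negP /(coord_weight b_basis b_weight av) wk.
  by move/eqP: ki; case; apply: root_mult1 wk wi.
have xi : coord b i x != 0.
  apply/eqP => xi; move/eqP: xy1.
  by rewrite (E _ ax) xi scale0r (form0l B_killing) eq_sym oner_eq0.
have zE : z = (coord b i z / coord b i x) *: x.
  have bE : b`_i = (coord b i x)^-1 *: x by rewrite {2}(E _ ax) scalerA mulVf // scale1r.
  by rewrite {1}(E _ az) bE scalerA.
by rewrite {2}zE BZl xy1 mulr1 -zE.
Qed.

(* The operator [ad x ad y] acts on the root space of [delta] by the trace of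
   [ad t_alpha] on the upper part [delta + N alpha] of the string.
   As the full string has trace 0 and the eigenvalues increase along it,
   the upper part has nonnegative trace. *)
Lemma lie_lie_eigen_ge0 alpha delta x y (lambda : C) : is_root alpha -> is_root delta ->
  in_root_space alpha x -> in_root_space (- alpha) y -> B x y = 1 ->
  (forall z, in_root_space delta z -> lie x (lie y z) = lambda *: z) -> 0 <= lambda.
Proof.
move=> ra rd ax ay xy1 lamP; have [a0 _] := ra; have apos := root_norm_gt0 ra.
have string0 := string_sum delta ra.
have [rho rr rE] := root_string_real ra rd; rewrite rE in string0.
set a := eval_dual alpha (t alpha) in apos string0 rE.
pose f gamma : C := (boolp.asbool (exists k : nat, gamma = delta + alpha *~ k))%:R.
have xyE := lie_opp ax ay; rewrite xy1 scale1r in xyE.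
have := weight_trace b_basis b_weight f (x := x) (y := y) (alpha := alpha).
rewrite xyE t_cartan => /(_ isT ax ay).
have -> : \sum_i (f (w i) - f (w i - alpha)) * coord b i (lie x (lie y b`_i)) =
    (\sum_i (w i == delta))%N%:R * lambda.
  rewrite natr_sum mulr_suml; apply: eq_bigr => i _.
  case: (eqVneq (w i) delta) => [wi|/eqP wi].
    rewrite lamP; last by rewrite -wi.
    rewrite linearZ /= (coord_basisE b_basis) eqxx mulr1 wi; congr (_ * _).
    rewrite /f boolp.asboolT; last by exists 0%N; rewrite mulr0z addr0.
    rewrite boolp.asboolF ?subr0 // => -[k] /addrI /eqP.
    rewrite -[- alpha]mulrN1z => /eqP.
    by move/(scalar_dual_inj a0).
  have -> : f (w i - alpha) = f (w i).
    congr (_%:R); congr (nat_of_bool _); apply: boolp.asbool_equiv_eq; split=> -[n].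
      move=> /(canRL (subrK _)) ->; exists n.+1.
      by rewrite -addn1 PoszD mulrzDr mulr1z addrA.
    case: n => [|n] E; first by case: wi; rewrite E mulr0z addr0.
    by exists n; rewrite E -addn1 PoszD mulrzDr mulr1z addrA addrK.
  by rewrite subrr !mul0r.
have m_gt0 : (0 : C) < (\sum_i (w i == delta))%N%:R.
  have [i wi] := root_weight b_basis b_weight rd.
  by rewrite ltr0n (bigD1 i) //= wi eqxx.
move=> E; rewrite -(pmulr_rge0 _ m_gt0) -E.
pose up i := if string alpha delta i is Some k then 0 <= k else false.
have fE i : f (w i) = (up i)%:R /\ (up i -> eval_dual (w i) (t alpha) =
    (if string alpha delta i is Some k then rho * a + k%:~R * a else 0)).
  rewrite /f /up; case Es: string => [k|]; last first.
    split=> //; rewrite boolp.asboolF // => -[k]; exact: (stringPn Es).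
  rewrite (stringP Es) eval_dualD eval_dualMz rE; split=> //.
  congr (_%:R); congr (nat_of_bool _); apply: (boolp.asbool_equiv_eqP idP); split.
    by move=> [n /addrI /(scalar_dual_inj a0) ->].
  by case: k Es => // n _ _; exists n.
have -> : \sum_i f (w i) * eval_dual (w i) (t alpha) = \sum_(i | up i)
    (if string alpha delta i is Some k then rho * a + k%:~R * a else 0).
  rewrite [RHS]big_mkcond; apply: eq_bigr => i _; have [-> fE2] := fE i.
  by case: (up i) fE2 => [->//|_]; rewrite ?mul1r ?mul0r.
(* The terms are [(rho + k) * a]. For [rho >= 0] those with [k >= 0] are nonnegative; for [rho < 0]
   the upper sum is minus the lower one, whose terms, with [k < 0], are nonpositive. *)
case: (real_ge0P rr) => [rho0|rho0].
  apply: sumr_ge0 => i; rewrite /up; case: string => // k k0.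
  by rewrite -mulrDl mulr_ge0 ?(ltW apos) // addr_ge0 // ler0z.
move: string0; rewrite (bigID up) /= => /eqP; rewrite addr_eq0 => /eqP ->.
rewrite oppr_ge0 sumr_le0 // => i; rewrite /up; case: string => // k; rewrite -ltNge => k0.
by rewrite -mulrDl mulr_le0_ge0 ?(ltW apos) // -[0]addr0 lerD ?(ltW rho0) // lerz0 ltW.
Qed.

End RootSpaces.

(** * The compact conjugation *)

Section CompactConjugation.
Variables (C : numClosedFieldType) (g : lieAlgType C) (h : {vspace g}).
Variables (c : C) (B : g -> g -> C).
Variables (b : (\dim {:g}).-tuple g) (w : 'I_(\dim {:g}) -> dual h).
Hypotheses (b_basis : basis_of {:g} b) (b_weight : forall i, in_root_space (w i) b`_i).
Hypotheses (B_killing : forall x y, B x y = c * killing x y) (c_gt0 : 0 < c).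
Hypothesis B_nondeg : forall x, (forall y, B y x = 0) -> x = 0.
Hypothesis h_self : forall x : g, in_root_space (0 : dual h) x <-> x \in h.
Variable t : dual h -> g.
Hypothesis t_dual : forall beta, is_dual_vector B beta (t beta).
Variables (e : dual h -> g) (N : dual h -> dual h -> C).
Hypothesis e_root : is_root_vectors B e N.
Variables (l : nat) (alpha : 'I_l -> dual h).
Hypothesis alpha_root : forall i, is_root (alpha i).
Hypothesis alpha_span : forall beta : dual h, exists k : 'I_l -> C,
  beta = \sum_i k i *: alpha i.
Implicit Types (x y z : g) (beta gamma : dual h).

Let BC := formC B_killing.
Let BZl := formZl B_killing.
Let BZr := formZr B_killing.
Let BDl := formDl B_killing.
Let BNr := formNr B_killing.
Let BNl := formNl B_killing.
Let Blie := form_lie B_killing.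
Let th := t_cartan t_dual.
Let t_lin := t_linear b_basis b_weight B_killing B_nondeg h_self t_dual.
Let t_uniq := dual_vector_uniq b_basis b_weight B_killing B_nondeg h_self.
Let oppr := opp_root b_basis b_weight B_killing B_nondeg.

Lemma e_weight beta : is_root beta -> in_root_space beta (e beta).
Proof. by case: e_root => e_w _ _; apply: e_w. Qed.

Lemma e_pair beta : is_root beta -> B (e beta) (e (- beta)) = 1.
Proof. by case: e_root => _ e_p _; apply: e_p. Qed.

Lemma root_neq0 beta : is_root beta -> beta <> 0. Proof. by case. Qed.

Lemma e_form beta gamma : is_root beta -> is_root gamma ->
  B (e beta) (e (- gamma)) = (beta == gamma)%:R.
Proof.
move=> rb rg; case: (eqVneq beta gamma) => [<-|/eqP bg]; first exact: e_pair.
apply: (form_orth B_killing (e_weight rb) (e_weight (oppr rg))).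
by move/eqP; rewrite subr_eq0 => /eqP.
Qed.

Lemma e_form_cartan beta x : is_root beta -> x \in h -> B x (e beta) = 0.
Proof.
by move=> rb xh; apply: form_orth_cartan (e_weight rb) (root_neq0 rb).
Qed.

Lemma e_line beta x : is_root beta -> in_root_space beta x ->
  x = B x (e (- beta)) *: e beta.
Proof.
move=> rb bx.
exact: (root_space_line b_basis b_weight B_killing c_gt0 B_nondeg h_self t_dual rb
  (e_weight rb) (e_weight (oppr rb)) (e_pair rb)).
Qed.


(** An element [x] of [h] is [t beta] for the form [beta = B^~ x], which is a combination of simple
    roots. *)
Lemma cartan_span (P : g -> Prop) : P 0 ->
  (forall a x y, P x -> P y -> P (a *: x + y)) ->
  (forall beta, is_root beta -> P (t beta)) -> forall x, x \in h -> P x.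
Proof.
move=> P0 P_lin P_t x xh.
have [beta betaP] := dual_of_fun h (f := B^~ x) (form_linl B_killing x).
have -> : x = t beta.
  apply: (t_uniq _ (t_dual beta)).
  by split=> // y yh; rewrite betaP.
have t0 : t 0 = 0.
  apply: (t_uniq (t_dual 0)).
  by split=> [|y _]; rewrite ?mem0v // (form0r B_killing) eval_dual0l.
have [k ->] := alpha_span beta; elim/big_ind: _ => [|y z Py Pz|i _].
- by rewrite t0.
- by rewrite -[y]scale1r t_lin; apply: P_lin.
- by rewrite -[_ *: _]addr0 t_lin t0; apply: P_lin; first exact: P_t.
Qed.

(** The vectors [e beta] and [t beta] span [g]. An induction principle also serves identities that
    are antilinear, and existence statements. *)
Lemma root_span_ind (P : g -> Prop) : P 0 ->
  (forall a x y, P x -> P y -> P (a *: x + y)) ->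
  (forall beta, is_root beta -> P (e beta)) ->
  (forall beta, is_root beta -> P (t beta)) -> forall x, P x.
Proof.
move=> P0 P_lin P_e P_t x; rewrite (basis_expand b_basis x).
elim/big_ind: _ => // [y z Py Pz|i _]; first by rewrite -[y]scale1r; apply: P_lin.
rewrite -[_ *: _]addr0; apply: (P_lin) => //.
case: (boolp.pselect (w i = 0)) => [wi|/(weight_root b_basis b_weight) ri].
  by apply: (cartan_span P0 P_lin P_t); apply/h_self; rewrite -wi.
by rewrite (e_line ri (b_weight i)) -[_ *: _]addr0; apply: P_lin => //; apply: P_e.
Qed.

(* The compact conjugation of [g], up to sign: the antilinear map exchanging
   [e beta] and [e (- beta)] and fixing every [t beta]. *)
Definition is_star x y := forall beta, is_root beta ->
  B y (e beta) = (B x (e (- beta)))^* /\ B y (t beta) = (B x (t beta))^*.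

Lemma is_star_uniq x y y' : is_star x y -> is_star x y' -> y = y'.
Proof.
move=> xy xy'; apply/eqP; rewrite -subr_eq0; apply/eqP; apply: B_nondeg.
apply: root_span_ind => [|a z z' Pz Pz'|beta rb|beta rb].
- exact: form0l.
- by rewrite BDl BZl Pz Pz' mulr0 addr0.
- have [E _] := xy _ rb; have [E' _] := xy' _ rb.
  by rewrite BC BDl BNl E E' subrr.
- have [_ E] := xy _ rb; have [_ E'] := xy' _ rb.
  by rewrite BC BDl BNl E E' subrr.
Qed.

Lemma is_star_linear a x x' y y' : is_star x x' -> is_star y y' ->
  is_star (a *: x + y) (a^* *: x' + y').
Proof.
move=> xx' yy' beta rb; have [E1 E2] := xx' _ rb; have [E3 E4] := yy' _ rb.
by rewrite !BDl !BZl E1 E2 E3 E4 !rmorphD !rmorphM.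
Qed.

Lemma is_star0 : is_star 0 0.
Proof. by move=> beta rb; rewrite !(form0l B_killing) rmorph0. Qed.

Lemma is_star_e beta : is_root beta -> is_star (e beta) (e (- beta)).
Proof.
move=> rb gamma rg; have rb' := oppr rb; have rg' := oppr rg.
rewrite (BC _ (e gamma)) !e_form // conjC_nat eq_sym; split=> //.
by rewrite BC e_form_cartan ?th // BC e_form_cartan ?th // rmorph0.
Qed.

Lemma is_star_t beta : is_root beta -> is_star (t beta) (t beta).
Proof.
move=> rb gamma rg; rewrite !e_form_cartan ?th ?rmorph0 //; last exact: oppr.
split=> //; rewrite (form_t t_dual) ?th //; apply/esym/CrealP.
exact: (root_eval_real b_basis b_weight B_killing c_gt0 B_nondeg h_self t_dual rb rg).
Qed.

(** The [t beta] are linearly dependent, so [star] cannot be prescribed freely on the spanning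
    vectors. Describing it by pairings separates uniqueness, from nondegeneracy, and existence, from
    closure under antilinear combinations. *)
Lemma is_star_exists x : exists y, is_star x y.
Proof.
elim/root_span_ind: x => [|a x y [x' xx'] [y' yy']|beta rb|beta rb].
- by exists 0; apply: is_star0.
- by exists (a^* *: x' + y'); apply: is_star_linear.
- by exists (e (- beta)); apply: is_star_e.
- by exists (t beta); apply: is_star_t.
Qed.

Definition star x := projT1 (boolp.cid (is_star_exists x)).

Lemma starP x : is_star x (star x).
Proof. by rewrite /star; case: boolp.cid. Qed.

Lemma star_eq x y : is_star x y -> star x = y.
Proof. exact/is_star_uniq/starP. Qed.

Lemma star_linear a x y : star (a *: x + y) = a^* *: star x + star y.
Proof. by apply/star_eq/is_star_linear; apply: starP. Qed.

Lemma star0 : star 0 = 0. Proof. exact/star_eq/is_star0. Qed.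

Lemma star_e beta : is_root beta -> star (e beta) = e (- beta).
Proof. by move=> rb; apply/star_eq/is_star_e. Qed.

Lemma star_t beta : is_root beta -> star (t beta) = t beta.
Proof. by move=> rb; apply/star_eq/is_star_t. Qed.

Lemma starK x : star (star x) = x.
Proof.
elim/root_span_ind: x => [|a x y Ex Ey|beta rb|beta rb].
- by rewrite !star0.
- by rewrite !star_linear conjCK Ex Ey.
- by rewrite star_e // star_e ?opprK //; apply: oppr.
- by rewrite !star_t.
Qed.

Lemma form_star x y : B (star x) (star y) = (B x y)^*.
Proof.
elim/root_span_ind: y => [|a y y' Ey Ey'|beta rb|beta rb].
- by rewrite star0 !(form0r B_killing) rmorph0.
- by rewrite star_linear !(form_linr B_killing) Ey Ey' rmorphD rmorphM.
- by rewrite star_e //; have [-> _] := starP x (oppr rb); rewrite opprK.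
- by rewrite star_t //; have [_ ->] := starP x rb.
Qed.

(* [N beta gamma ^+ 2] is the eigenvalue of [ad (e beta) ad (e (- beta))]
   on the root space of [beta + gamma]. *)
Lemma structure_constant_real beta gamma : is_root beta -> is_root gamma ->
  is_root (beta + gamma) -> N beta gamma \is Num.real.
Proof.
move=> rb rg rbg; have [_ _ eN] := e_root.
have [E1 N1] := eN _ _ rb rg rbg.
have [rb' rg'] := (oppr rb, oppr rg).
have [|E2 _] := eN _ _ rb' rg'; first by rewrite -opprD; apply: oppr.
(* Invariance gives the coefficient [- N (- beta) (- gamma)], which the sign rule turns into
   [N beta gamma]; hence the eigenvalue below is a square. *)
have E3 : lie (e (- beta)) (e (beta + gamma)) = N beta gamma *: e gamma.
  rewrite (e_line rg (x := lie _ _)); last first.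
    by rewrite -[X in in_root_space X](addKr beta); apply: in_root_space_lie; apply: e_weight.
  congr (_ *: _); rewrite lieC BNl Blie E2 BZr -opprD e_form // eqxx mulr1 N1 opprK //.
have : 0 <= N beta gamma ^+ 2.
  apply: (lie_lie_eigen_ge0 b_basis b_weight B_killing c_gt0 B_nondeg h_self t_dual rb rbg
    (e_weight rb) (e_weight rb') (e_pair rb)) => z /(e_line rbg) ->.
  by rewrite !linearZ /= E3 linearZ /= E1 !scalerA expr2; congr (_ *: _); rewrite mulrA.
move=> N2; have := sqrtC_ge0 (N beta gamma ^+ 2); rewrite N2 => sN2.
have /eqP := sqrtCK (N beta gamma ^+ 2); rewrite eqf_sqr => /orP[] /eqP E.
  by rewrite -E ger0_real.
by rewrite -[N _ _]opprK -E realN ger0_real.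
Qed.

(** When [beta + gamma] is a root, both sides are [N beta gamma] times [e (- (beta + gamma))]: on
    the left because the constant is real, on the right because reversing the bracket absorbs the
    sign in [N (- beta) (- gamma) = - N beta gamma]. *)
Lemma star_lie_ee beta gamma : is_root beta -> is_root gamma ->
  star (lie (e beta) (e gamma)) = lie (e (- gamma)) (e (- beta)).
Proof.
move=> rb rg; have [rb' rg'] := (oppr rb, oppr rg).
have bgw : in_root_space (beta + gamma) (lie (e beta) (e gamma)).
  by apply: in_root_space_lie; apply: e_weight.
have bgw' : in_root_space (- gamma - beta) (lie (e (- gamma)) (e (- beta))).
  by apply: in_root_space_lie; apply: e_weight.
case: (eqVneq (beta + gamma) 0) => [bg0|/eqP bg0].
  have -> : gamma = - beta by apply/eqP; rewrite -addr_eq0 addrC bg0.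
  have E := lie_opp b_basis b_weight B_killing B_nondeg h_self t_dual
    (e_weight rb) (e_weight rb').
  by rewrite opprK E e_pair // scale1r star_t.
case: (boolp.pselect (is_root (beta + gamma))) => [rbg|nrbg]; last first.
  rewrite (not_root_eq0 b_basis b_weight bgw) // star0.
  rewrite (not_root_eq0 b_basis b_weight bgw') //.
    by rewrite -opprD addrC => /eqP; rewrite oppr_eq0 => /eqP.
  by move=> /oppr; rewrite opprB opprK.
have [_ _ eN] := e_root.
have [E1 N1] := eN _ _ rb rg rbg.
have [|E2 _] := eN _ _ rb' rg'; first by rewrite -opprD; apply: oppr.
rewrite [RHS]lieC E2 E1 N1 scaleNr opprK -opprD -[_ *: _]addr0 star_linear star0 addr0.
by rewrite star_e // (CrealP _) // structure_constant_real.
Qed.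

Lemma starN x : star (- x) = - star x.
Proof.
by have := star_linear (-1) x 0; rewrite star0 !addr0 scaleN1r rmorphN1 scaleN1r.
Qed.

Lemma starZ a x : star (a *: x) = a^* *: star x.
Proof. by have := star_linear a x 0; rewrite star0 !addr0. Qed.

Lemma starD x y : star (x + y) = star x + star y.
Proof. by have := star_linear 1 x y; rewrite rmorph1 !scale1r. Qed.

Lemma star_lie_te beta gamma : is_root beta -> is_root gamma ->
  star (lie (t beta) (e gamma)) = lie (e (- gamma)) (t beta).
Proof.
move=> rb rg; rewrite (e_weight rg) ?th // [RHS]lieC (e_weight (oppr rg)) ?th //.
rewrite eval_dualN scaleNr opprK starZ star_e // (CrealP _) //.
exact: (root_eval_real b_basis b_weight B_killing c_gt0 B_nondeg h_self t_dual rb rg).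
Qed.

Lemma lie_tt beta gamma : lie (t beta) (t gamma) = 0.
Proof.
have /h_self t0 := th gamma.
by rewrite t0 ?th // eval_dual0l scale0r.
Qed.

Lemma star_lie x y : star (lie x y) = lie (star y) (star x).
Proof.
elim/root_span_ind: x => [|a x x' Ex Ex'|beta rb|beta rb].
- by rewrite star0 lie0l linear0 star0.
- by rewrite lieDl lieZl !star_linear linearP /= Ex Ex'.
- elim/root_span_ind: y => [|a y y' Ey Ey'|gamma rg|gamma rg].
  + by rewrite star0 linear0 lie0l star0.
  + by rewrite linearP /= !star_linear lieDl lieZl Ey Ey'.
  + by rewrite !star_e // star_lie_ee.
  + by rewrite star_t // star_e // lieC starN star_lie_te // [RHS]lieC.
- elim/root_span_ind: y => [|a y y' Ey Ey'|gamma rg|gamma rg].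
  + by rewrite star0 linear0 lie0l star0.
  + by rewrite linearP /= !star_linear lieDl lieZl Ey Ey'.
  + by rewrite star_t // star_e // star_lie_te.
  + by rewrite !star_t // !lie_tt star0.
Qed.

Lemma root_weight_inj i j : w i <> 0 -> w j = w i -> j = i.
Proof.
move=> wi ji; have ri := weight_root b_basis b_weight wi.
exact: (root_mult1 b_basis b_weight B_killing c_gt0 B_nondeg h_self t_dual ri).
Qed.

Lemma orth_cartan x : (forall beta, is_root beta -> B x (e beta) = 0) -> x \in h.
Proof.
move=> xe; rewrite (basis_expand b_basis x) rpred_sum // => i _.
case: (boolp.pselect (w i = 0)) => [wi|wi]; first by apply/rpredZ/h_self; rewrite -wi.
have ri := weight_root b_basis b_weight wi.
suff -> : coord b i x = 0 by rewrite scale0r rpred0.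
have := xe _ (oppr ri); rewrite {1}(basis_expand b_basis x) (form_suml B_killing).
rewrite (bigD1 i) //= big1 => [|j ji]; last first.
  rewrite BZl; case: (boolp.pselect (w j = 0)) => [wj|wj].
    rewrite e_form_cartan ?mulr0 //; first exact: oppr.
    by apply/h_self; rewrite -wj.
  have rj := weight_root b_basis b_weight wj.
  rewrite (e_line rj (b_weight j)) BZl e_form //.
  case: (eqVneq (w j) (w i)) => [wij|_]; last by rewrite !mulr0.
  by rewrite (root_weight_inj wi wij) eqxx in ji.
rewrite addr0 BZl => /eqP; rewrite mulf_eq0 => /orP[/eqP //|/eqP Bi].
by have := e_line ri (b_weight i); rewrite Bi scale0r => /(basis_elt_neq0 b_basis).
Qed.

(** Write [x] as [x0] in [h] plus the sum of the [k i *: e (w i)]. Then [B x (star x)] is the sum of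
    the squared moduli of the [k i] plus [B x0 (star x0)], which is [c] times the sum of the squared
    moduli of the [w i] at [x0]. *)
Lemma star_eq0 x : B x (star x) = 0 -> x = 0.
Proof.
(* By multiplicity one, the indices satisfying [P] enumerate the roots without repetition. *)
pose P i := w i != 0; pose k i := B x (e (- w i)).
pose x0 := x - \sum_(i | P i) k i *: e (w i).
have rw i : P i -> is_root (w i) by move/eqP/(weight_root b_basis b_weight).
have kE i : P i -> B x0 (e (- w i)) = 0.
  move=> Pi; rewrite BDl BNl (form_suml B_killing) (bigD1 i) //= BZl (e_pair (rw _ Pi)).
  rewrite mulr1 big1 ?addr0 ?subrr // => j /andP[Pj ji].
  rewrite BZl (e_form (rw _ Pj) (rw _ Pi)); case: (eqVneq (w j) (w i)) => [wij|_]; last by rewrite mulr0.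
  by rewrite (root_weight_inj _ wij) ?eqxx // in ji; apply/eqP.
have kE' beta : is_root beta -> B x0 (e beta) = 0.
  move=> rb; have [j wi] := root_weight b_basis b_weight (oppr rb).
  rewrite -[beta]opprK -wi kE //; apply/eqP; rewrite wi; exact: root_neq0 (oppr rb).
have x0h := orth_cartan kE'.
have sx0h : star x0 \in h.
  by apply: orth_cartan => beta rb; have [-> _] := starP x0 rb; rewrite kE' ?rmorph0 //; apply: oppr.
have xE : x = x0 + \sum_(i | P i) k i *: e (w i) by rewrite subrK.
have B0 : B x (star x0) = B x0 (star x0).
  rewrite xE BDl (form_suml B_killing) big1 ?addr0 -?xE // => i Pi.
  by rewrite BZl BC e_form_cartan ?mulr0 //; apply: rw.
have Bi : B x (star x - star x0) = \sum_(i | P i) k i * (k i)^*.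
  have -> : star x - star x0 = \sum_(i | P i) (k i)^* *: e (- w i).
    rewrite -starN -starD {1}xE addrAC subrr add0r; elim/big_rec2: _ => [|i y z Pi <-]; first exact: star0.
    by rewrite star_linear star_e //; apply: rw.
  by rewrite (form_sumr B_killing); apply: eq_bigr => i _; rewrite BZr mulrC.
rewrite -[star x](subrK (star x0)) (formDr B_killing) Bi B0.
have B0E : B x0 (star x0) =
    c * \sum_i eval_dual (w i) x0 * (eval_dual (w i) x0)^*.
  rewrite B_killing (killing_weight b_basis b_weight) //; congr (_ * _).
  apply: eq_bigr => i _; congr (_ * _); case: (boolp.pselect (w i = 0)) => [->|wi].
    by rewrite !eval_dual0l rmorph0.
  have ri := weight_root b_basis b_weight wi.
  by have [_] := starP x0 ri; rewrite !(form_t t_dual).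
have k_ge0 : 0 <= \sum_(i | P i) k i * (k i)^*.
  by apply: sumr_ge0 => i _; apply: mul_conjC_ge0.
have s_ge0 : 0 <= \sum_i eval_dual (w i) x0 * (eval_dual (w i) x0)^*.
  by apply: sumr_ge0 => i _; apply: mul_conjC_ge0.
move/eqP; rewrite paddr_eq0 // ?B0E ?mulr_ge0 ?(ltW c_gt0) // => /andP[].
rewrite psumr_eq0 => [/allP k0|i _]; last exact: mul_conjC_ge0.
rewrite mulf_eq0 (gt_eqF c_gt0) /= psumr_eq0 => [/allP a0|i _]; last exact: mul_conjC_ge0.
have -> : x = x0.
  rewrite xE big1 ?addr0 // => i Pi; have := k0 i (mem_index_enum _).
  by rewrite Pi /= mul_conjC_eq0 => /eqP ->; rewrite scale0r.
apply: B_nondeg; apply: root_span_ind => [|a y y' Ey Ey'|beta rb|beta rb].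
- exact: form0l.
- by rewrite BDl BZl Ey Ey' mulr0 addr0.
- by rewrite BC kE'.
- rewrite BC (form_t t_dual) //; have [i <-] := root_weight b_basis b_weight rb.
  by have := a0 i (mem_index_enum _); rewrite /= mul_conjC_eq0 => /eqP.
Qed.

End CompactConjugation.

(** * Normal elements and their centralizers *)

(** The hypothesis lets a repeated factor be deleted from any product of factors [A - z] killing a
    vector, so the minimal polynomial divides the product over its distinct roots. *)
Lemma ker2_diagonalizable (C : closedFieldType) (n : nat) (A : 'M[C]_n) :
  (forall (a : C) (u : 'rV_n),
     u *m (A - a%:M) *m (A - a%:M) = 0 -> u *m (A - a%:M) = 0) ->
  diagonalizable A.
Proof.
case: n A => [|m] A A_ker2.
  by exists 1%:M; rewrite ?unitmx1 //; apply/is_diag_mxP => -[].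
apply/diagonalizableP.
have [r rE] := closed_field_poly_normal (mxminpoly A).
rewrite (monicP (mxminpoly_monic A)) scale1r in rE.
exists (undup r); rewrite ?undup_uniq //; apply: mxminpoly_min.
have ->: horner_mx A (\prod_(x <- undup r) ('X - x%:P)) =
    1%:M *m horner_mx A (\prod_(x <- undup r) ('X - x%:P)) by rewrite mul1mx.
apply/row_matrixP => i; rewrite row_mul row0.
have : row i 1%:M *m horner_mx A (\prod_(x <- r) ('X - x%:P)) = 0.
  by rewrite -rE mx_root_minpoly mulmx0.
have hX z : horner_mx A ('X - z%:P) = A - z%:M.
  by rewrite rmorphB /= horner_mx_X horner_mx_C.
elim: r {rE} (row i _) => [|z r IHr] u //=; rewrite big_cons rmorphM /= mulmxA.
move=> /IHr; case: ifP => zr; last by rewrite big_cons rmorphM /= mulmxA.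
(* Here [z] occurs again later: with [q] the remaining factors, [u *m q(A)] is killed by the square
   of [A - z], hence by [A - z]. *)
have zr' : z \in undup r by rewrite mem_undup.
rewrite (big_rem z zr') /=; set q := \prod_(y <- rem _ _) _.
rewrite mulrC rmorphM /= hX -!mulmxA => E.
have comm : horner_mx A q *m (A - z%:M) = (A - z%:M) *m horner_mx A q.
  by rewrite -hX; apply: comm_horner_mx2.
rewrite mulmxA; apply: A_ker2; rewrite -!mulmxA -[RHS]E.
by congr (u *m _); rewrite !mulmxA comm.
Qed.

Section NormalElements.
Variables (C : numClosedFieldType) (g : lieAlgType C) (c : C) (B : g -> g -> C).
Hypothesis B_killing : forall x y, B x y = c * killing x y.
Hypothesis B_nondeg : forall x, (forall y, B y x = 0) -> x = 0.
Variable star : g -> g.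
Hypothesis star_linear : forall a x y, star (a *: x + y) = a^* *: star x + star y.
Hypothesis starK : forall x, star (star x) = x.
Hypothesis star_lie : forall x y, star (lie x y) = lie (star y) (star x).
Hypothesis form_star : forall x y, B (star x) (star y) = (B x y)^*.
Hypothesis star_eq0 : forall x, B x (star x) = 0 -> x = 0.
Implicit Types (x y z a : g).

Let BC := formC B_killing.
Let BDl := formDl B_killing.
Let BDr := formDr B_killing.
Let BZl := formZl B_killing.
Let BZr := formZr B_killing.
Let BNr := formNr B_killing.
Let BNl := formNl B_killing.

Lemma antilinear0 : star 0 = 0.
Proof.
by have := star_linear (-1) 0 0; rewrite scaler0 addr0 rmorphN1 scaleN1r addNr.
Qed.

Lemma antilinearZ k x : star (k *: x) = k^* *: star x.
Proof. by have := star_linear k x 0; rewrite antilinear0 !addr0. Qed.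

Lemma antilinearD x y : star (x + y) = star x + star y.
Proof. by have := star_linear 1 x y; rewrite rmorph1 !scale1r. Qed.

Lemma antilinearN x : star (- x) = - star x.
Proof. by rewrite -!scaleN1r antilinearZ rmorphN1. Qed.

Lemma form_adjoint a x y : B (lie a x) (star y) = B x (star (lie (star a) y)).
Proof.
by rewrite star_lie starK lieC BNl (form_lie B_killing) [in RHS]lieC BNr.
Qed.

(** With [z = lie (star a) x - k^* *: x], adjointness turns [B z (star z)] into a pairing of [x]
    with [ad a - k] applied to [z]; this vanishes because [ad a] commutes with [ad (star a)] and
    [ad a - k] kills [x]. *)
Lemma normal_eigen a x k : lie a (star a) = 0 -> lie a x = k *: x ->
  lie (star a) x = k^* *: x.
Proof.
move=> aa ax; apply/eqP; rewrite -subr_eq0; apply/eqP; apply: star_eq0.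
set z := _ - _; rewrite {1}/z BDl BNl form_adjoint starK BZl.
rewrite -BZr -antilinearZ -BNr -BDr -antilinearN -antilinearD.
rewrite /z linearB linearZ /= lie_lie aa lie0l add0r ax linearZ /=.
by rewrite scalerBr !scalerA [k^* * k]mulrC subrr antilinear0 (form0r B_killing).
Qed.

(** The vector [lie a x - k *: x] is in the image of [ad a - k]; being an eigenvector it is also
    killed by the adjoint, hence orthogonal to that image. *)
Lemma normal_ker2 a x k : lie a (star a) = 0 ->
  lie a (lie a x - k *: x) = k *: (lie a x - k *: x) -> lie a x - k *: x = 0.
Proof.
move=> aa; set z := _ - _ => /(normal_eigen aa) az; apply: star_eq0.
rewrite {1}/z BDl BNl form_adjoint az BZl antilinearZ conjCK BZr subrr //.
Qed.

Lemma normal_diagonalizable a : lie a (star a) = 0 -> diagonalizable (mx_of_end (ad a)).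
Proof.
move=> aa; apply: ker2_diagonalizable => k u; set v := vbasis {:g}.
have vb : basis_of {:g} v by apply: vbasisP.
have E (y : 'rV_(\dim {:g})) : y *m (mx_of_end (ad a) - k%:M) =
    rVof v (lie a (vecof v y) - k *: vecof v y).
  rewrite mulmxBr mul_mx_scalar /mx_of_end mul_mxof /= adE.
  by rewrite -[in RHS]scaleNr [in RHS]addrC rVof_linear (vecofK vb) scaleNr addrC.
rewrite !E (rVofK vb) => /eqP; rewrite (rVof_eq0 vb) subr_eq0 => /eqP.
by move=> /(normal_ker2 aa) ->; rewrite linear0.
Qed.

(** * The centralizer of a normal element *)

Variable E : g.
Hypothesis E_normal : lie E (star E) = 0.

Lemma centralizer_lie x y : lie E x = 0 -> lie E y = 0 -> lie E (lie x y) = 0.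
Proof. by move=> Ex Ey; rewrite lie_lie Ex Ey lie0l linear0 addr0. Qed.

Lemma centralizer_star x : lie E x = 0 -> lie E (star x) = 0.
Proof.
move=> Ex; have := normal_eigen (k := 0) (x := x) E_normal; rewrite scale0r => /(_ Ex).
rewrite rmorph0 scale0r => /(congr1 star); rewrite star_lie starK antilinear0.
by rewrite lieC => /eqP; rewrite oppr_eq0 => /eqP.
Qed.

Section Grading.
Variables (s : nat) (hom : int -> g -> Prop) (pr : nat -> g -> g).
Hypothesis hom_lie : forall i j x y, hom i x -> hom j y -> hom (i + j) (lie x y).
Hypothesis hom_star : forall i x, hom i x -> hom (- i) (star x).
Hypothesis hom_per : forall i x, hom (i + s%:Z) x -> hom i x.
Hypothesis pr_sum : forall x, x = \sum_(k < s) pr k x.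
Hypothesis pr_hom : forall k x, hom k%:Z (pr k x).
Hypothesis pr_centralizer : forall k x, lie E x = 0 -> lie E (pr k x) = 0.
Hypothesis hom0 : forall x, hom 0 x -> lie E x = 0 -> x = 0.

(* Kreknin's argument: if the components of degree less than k are central, then
   ad x, for x of degree k, is nilpotent, because iterating a shift by k modulo s
   must reach a degree less than k; since ad x is normal, it vanishes. *)
Lemma homogeneous_central k x y : (k < s)%N -> hom k%:Z x -> lie E x = 0 ->
  lie E y = 0 -> lie x y = 0.
Proof.
elim/ltn_ind: k x y => k IHk x y ks xk Ex Ey.
have [k0|k_gt0] := posnP k.
  by rewrite (hom0 (x := x)) ?lie0l // -[0]/(0%N%:Z) -k0.
(* The degrees of [x] and [star x] cancel, and the centralizer has no part of degree 0: homogeneous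
   elements are normal. *)
have xx : lie x (star x) = 0.
  apply: hom0; last exact: centralizer_lie (centralizer_star Ex).
  by rewrite -(subrr k%:Z); apply: hom_lie => //; apply: hom_star.
have sq z : lie x (lie x z) = 0 -> lie x z = 0.
  by have := @normal_ker2 x z 0 xx; rewrite !scale0r subr0.
rewrite (pr_sum y) linear_sum big1 // => j _ /=.
move: {y Ey} (pr j y) (pr_hom j y) (pr_centralizer j Ey) (ltn_ord j) => y.
(* By [sq] it suffices to kill [lie x y], whose degree is larger by [k]; the measure [s - j]
   decreases until the degree passes [s]. *)
move: (nat_of_ord j) => {}j; have [m] := ubnP (s - j); elim: m j y => // m IHm j y mj yj Ey js.
apply: sq; have [kj|kj] := ltnP (k + j) s.
  have jkj : (j < k + j)%N by rewrite -[X in (X < _)%N]add0n ltn_add2r.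
  apply: (IHm (k + j)%N) kj; last exact: centralizer_lie.
    by apply: leq_trans (ltn_sub2l js jkj) _; rewrite -ltnS.
  by rewrite PoszD; apply: hom_lie.
(* Modulo [s] the degree of [lie x y] is now [k + j - s < k], so the outer induction makes it
   central. *)
rewrite lieC (IHk (k + j - s)%N) ?oppr0 //.
- by rewrite ltn_subLR // addnC ltn_add2r.
- by rewrite ltn_subLR // -addnS leq_add // ltnW.
- by apply: hom_per; rewrite -PoszD subnK // PoszD; apply: hom_lie.
- exact: centralizer_lie.
Qed.

Lemma centralizer_abelian : is_abelian (centralizer E).
Proof.
move=> x y /centralizerP Ex /centralizerP Ey; rewrite (pr_sum x) lie_suml.
rewrite big1 // => j _; apply: (homogeneous_central (ltn_ord j)) => //.
exact: pr_centralizer.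
Qed.
End Grading.

Hypothesis E_abelian : is_abelian (centralizer E).
Local Notation h' := (centralizer E).

(** All elements of [h'] are normal, so [g] has a basis of weight vectors for [h']; if every root
    vanishes at [x], then [ad x = 0] and [x] is in the radical of [B]. *)
Lemma centralizer_root_ext x : x \in h' ->
  (forall beta : dual h', is_root beta -> eval_dual beta x = 0) -> x = 0.
Proof.
move=> xh bx; have h_diag y : y \in h' -> diagonalizable (mx_of_end (ad y)).
  move=> yh; apply: normal_diagonalizable; apply: E_abelian => //.
  by apply/centralizerP/centralizer_star/centralizerP.
have [b [w [bb bw]]] := weight_basis E_abelian h_diag.
have ad0 y : lie x y = 0.
  rewrite (basis_expand bb y) linear_sum big1 // => i _; rewrite linearZ /= bw //.
  case: (boolp.pselect (w i = 0)) => [->|/(weight_root bb bw) /bx ->].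
    by rewrite eval_dual0l scale0r scaler0.
  by rewrite scale0r scaler0.
apply: B_nondeg => y; rewrite BC B_killing /killing.
have -> : ad x = 0 by apply/lfunP => z; rewrite adE ad0 zero_lfunE.
by rewrite comp_lfun0l /mx_of_end linear0 mxtrace0 mulr0.
Qed.

(** [B] is nondegenerate on [h'] by definiteness: [star x] lies in [h'] with [x]. *)
Lemma centralizer_dual_vector (beta : dual h') : exists H, is_dual_vector B beta H.
Proof.
have [|H Hh HP] := representable (form_linl B_killing) (form_linr B_killing) (U := h') _ beta.
  move=> x xh Bx; apply: star_eq0; rewrite BC; apply: Bx.
  by apply/centralizerP/centralizer_star/centralizerP.
by exists H; split.
Qed.

Lemma centralizer_dual_vector_uniq (beta : dual h') H H' :
  is_dual_vector B beta H -> is_dual_vector B beta H' -> H = H'.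
Proof.
move=> [Hh HP] [Hh' HP']; apply/eqP; rewrite -subr_eq0; apply/eqP; apply: star_eq0.
rewrite BC BDr BNr HP ?HP' ?subrr //.
all: by apply/centralizerP/centralizer_star/centralizerP; rewrite rpredB.
Qed.

(** A root vector is a common eigenvector of [ad x] and of its adjoint [ad (star x)], so the two
    eigenvalues are conjugate. *)
Lemma root_star (beta : dual h') x : is_root beta -> x \in h' ->
  eval_dual beta (star x) = (eval_dual beta x)^*.
Proof.
move=> [_ [v v0 bv]] xh.
have sxh : star x \in h' by apply/centralizerP/centralizer_star/centralizerP.
have vv : B v (star v) != 0 by apply/eqP => /star_eq0.
apply: (mulIf vv); rewrite -BZl -bv // form_adjoint starK bv //.
by rewrite antilinearZ BZr.
Qed.

Lemma dual_vector_star (beta : dual h') H : is_root beta ->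
  is_dual_vector B beta H -> star H = H.
Proof.
move=> rb HP; have [Hh HB] := HP; apply: centralizer_dual_vector_uniq HP.
have shh x : x \in h' -> star x \in h'.
  by move=> xh; apply/centralizerP/centralizer_star/centralizerP.
split=> [|x xh]; first exact: shh.
by rewrite -[x]starK form_star HB ?shh // root_star ?conjCK ?starK.
Qed.

Lemma self_adjoint_root_real (beta : dual h') x : is_root beta -> x \in h' ->
  star x = x -> eval_dual beta x \is Num.real.
Proof. by move=> rb xh sx; apply/CrealP; rewrite -root_star ?sx. Qed.

End NormalElements.

(** * The cyclic element *)

Section CyclicElement.
Variables (C : numClosedFieldType) (g : lieAlgType C) (h : {vspace g}).
Variables (c : C) (B : g -> g -> C).
Variables (b : (\dim {:g}).-tuple g) (w : 'I_(\dim {:g}) -> dual h).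
Hypotheses (b_basis : basis_of {:g} b) (b_weight : forall i, in_root_space (w i) b`_i).
Hypotheses (B_killing : forall x y, B x y = c * killing x y) (c_gt0 : 0 < c).
Hypothesis B_nondeg : forall x, (forall y, B y x = 0) -> x = 0.
Hypothesis h_self : forall x : g, in_root_space (0 : dual h) x <-> x \in h.
Variable t : dual h -> g.
Hypothesis t_dual : forall beta, is_dual_vector B beta (t beta).
Variables (e : dual h -> g) (N : dual h -> dual h -> C).
Hypothesis e_root : is_root_vectors B e N.
Variables (l : nat) (alpha : 'I_l -> dual h) (psi : dual h) (q : 'I_l -> nat).
Hypothesis l_gt1 : (1 < l)%N.
Hypothesis alpha_simple : is_simple_system alpha.
Hypothesis psi_highest : is_highest_root alpha psi.
Hypothesis psi_q : psi = \sum_(i < l) alpha i *+ q i.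
Implicit Types (x y z : g) (beta gamma : dual h).

Let oppr := opp_root b_basis b_weight B_killing B_nondeg.
Let BC := formC B_killing.
Let BZl := formZl B_killing.
Let BZr := formZr B_killing.

Let alpha_root i : is_root (alpha i). Proof. by case: alpha_simple. Qed.

Let base : l.-tuple (dual h) := [tuple alpha i | i < l].

Let base_basis : basis_of {: dual h} base.
Proof. by case: alpha_simple => _ + _; congr (basis_of _ _). Qed.

Let baseE (i : 'I_l) : base`_i = alpha i.
Proof. by rewrite -tnth_nth tnth_mktuple. Qed.

Definition simple_coord (i : 'I_l) : dual h -> C := coord base i.

Lemma simple_coord_alpha (i j : 'I_l) : simple_coord i (alpha j) = (j == i)%:R.
Proof. by rewrite -baseE /simple_coord coord_free // (basis_free base_basis). Qed.

Lemma simple_coordD i beta gamma :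
  simple_coord i (beta + gamma) = simple_coord i beta + simple_coord i gamma.
Proof. exact: linearD. Qed.

Lemma simple_coordN i beta : simple_coord i (- beta) = - simple_coord i beta.
Proof. exact: linearN. Qed.

Lemma simple_coord_sum i (n : 'I_l -> nat) :
  simple_coord i (\sum_(j < l) alpha j *+ n j) = (n i)%:R.
Proof.
have aE j := simple_coord_alpha i j; rewrite /simple_coord in aE *.
rewrite linear_sum (bigD1 i) //= linearMn /= aE eqxx big1 ?addr0 // => j ji.
by rewrite linearMn /= aE (negPf ji) mul0rn.
Qed.

Lemma simple_span beta : exists k : 'I_l -> C, beta = \sum_i k i *: alpha i.
Proof.
exists (simple_coord^~ beta); rewrite {1}(coord_basis base_basis (memvf beta)).
by apply: eq_bigr => i _; rewrite baseE.
Qed.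

Let alpha_span := simple_span.

Lemma natr_neqN1 n : n%:R != -1 :> C.
Proof. by rewrite -subr_eq0 opprK natr1 pnatr_eq0. Qed.

(** The i-th coordinate of [psi - alpha i] is [q i - 1], and it is a natural number. *)
Lemma highest_coord_gt0 i : (0 < q i)%N.
Proof.
have [_ /(_ _ (alpha_root i))[n]] := psi_highest.
move=> /(congr1 (simple_coord i)); rewrite simple_coordD simple_coordN psi_q.
rewrite !simple_coord_sum simple_coord_alpha eqxx; case: (q i) => // /eqP.
by rewrite sub0r eq_sym (negPf (natr_neqN1 _)).
Qed.

Lemma highest_add_not_root i : ~ is_root (alpha i + psi).
Proof.
move=> r; have [_ /(_ _ r)[n]] := psi_highest.
rewrite opprD addrCA subrr addr0 => /(congr1 (simple_coord i)).
rewrite simple_coordN simple_coord_sum simple_coord_alpha eqxx => /esym/eqP.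
by rewrite (negPf (natr_neqN1 _)).
Qed.

Lemma simple_sub_not_root i j : i != j -> ~ is_root (alpha i - alpha j).
Proof.
move=> ij r; have [_ _ /(_ _ r)[n [E|E]]] := alpha_simple.
  have := congr1 (simple_coord j) E; rewrite simple_coordD simple_coordN.
  rewrite !simple_coord_alpha (negPf ij) eqxx sub0r simple_coord_sum => /esym/eqP.
  by rewrite (negPf (natr_neqN1 _)).
have := congr1 (simple_coord i) E; rewrite simple_coordD !simple_coordN.
rewrite !simple_coord_alpha eq_sym (negPf ij) eqxx subr0 simple_coord_sum => /esym/eqP.
by rewrite eqr_oppLR (negPf (natr_neqN1 _)).
Qed.

Local Notation ah := (extend0 (- psi) alpha).
Local Notation qh := (extend0 1%N q).
Local Notation s := (coxeter_number q).

Let ah0 : ah ord0 = - psi. Proof. by rewrite /extend0 unlift_none. Qed.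
Let ahS (i : 'I_l) : ah (lift ord0 i) = alpha i. Proof. by rewrite /extend0 liftK. Qed.
Let qh0 : qh ord0 = 1%N. Proof. by rewrite /extend0 unlift_none. Qed.
Let qhS (i : 'I_l) : qh (lift ord0 i) = q i. Proof. by rewrite /extend0 liftK. Qed.

Lemma coxeterE : s = (\sum_(i < l) q i).+1.
Proof. by rewrite /coxeter_number big_ord_recl qh0; under eq_bigr do rewrite qhS. Qed.

Lemma extended_coord_gt0 i : (0 < qh i)%N.
Proof. by case: (unliftP ord0 i) => [j ->|->]; rewrite ?qhS ?qh0 ?highest_coord_gt0. Qed.

Lemma extended_root i : is_root (ah i).
Proof.
by case: (unliftP ord0 i) => [j ->|->]; rewrite ?ahS ?ah0 //; case: psi_highest => /oppr.
Qed.

(** This kills the off-diagonal brackets in [lie E (star E)]. A difference of simple roots has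
    coordinates of both signs, and [alpha i + psi] would be a root above [psi]. *)
Lemma extended_sub i j : i != j -> ah i - ah j <> 0 /\ ~ is_root (ah i - ah j).
Proof.
have psi_add k : alpha k + psi <> 0.
  move/(congr1 (simple_coord k)); rewrite simple_coordD psi_q simple_coord_sum.
  rewrite simple_coord_alpha eqxx /simple_coord linear0 nat1r => /eqP.
  by rewrite pnatr_eq0.
case: (unliftP ord0 i) => [i' ->|->]; case: (unliftP ord0 j) => [j' ->|->].
- rewrite !ahS (inj_eq (@lift_inj _ _)) => ij; split; last exact: simple_sub_not_root.
  move/(congr1 (simple_coord i')); rewrite simple_coordD simple_coordN.
  rewrite !simple_coord_alpha eqxx eq_sym (negPf ij) subr0 /simple_coord linear0.
  by move/eqP; rewrite oner_eq0.
- by rewrite ahS ah0 opprK => _; split=> //; apply: highest_add_not_root.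
- rewrite ahS ah0 -opprD addrC => _; split.
    by move/eqP; rewrite oppr_eq0 => /eqP /psi_add.
  by move/oppr; rewrite opprK; apply: highest_add_not_root.
- by rewrite eqxx.
Qed.

(** It fails in rank 1, where [psi] is the simple root; for [l > 1], [psi] has a positive coordinate
    at a second simple root. *)
Lemma extended_add_neq0 i j : ah i + ah j <> 0.
Proof.
have psi_alpha k : psi <> alpha k.
  have [m mk] : exists m : 'I_l, m != k.
    case: (eqVneq k (Ordinal (ltnW l_gt1))) => [->|k0].
      by exists (Ordinal l_gt1).
    by exists (Ordinal (ltnW l_gt1)); rewrite eq_sym.
  move/(congr1 (simple_coord m)); rewrite psi_q simple_coord_sum simple_coord_alpha.
  rewrite eq_sym (negPf mk) => /eqP; rewrite pnatr_eq0 => /eqP qm.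
  by have := highest_coord_gt0 m; rewrite qm.
case: (unliftP ord0 i) => [i' ->|->]; case: (unliftP ord0 j) => [j' ->|->].
- rewrite !ahS; move/(congr1 (simple_coord i')); rewrite simple_coordD.
  rewrite !simple_coord_alpha eqxx /simple_coord linear0 nat1r => /eqP.
  by rewrite pnatr_eq0.
- by rewrite ahS ah0 => /eqP; rewrite subr_eq0 => /eqP /esym /psi_alpha.
- by rewrite ahS ah0 addrC => /eqP; rewrite subr_eq0 => /eqP /esym /psi_alpha.
- rewrite ah0 -opprD => /(congr1 (simple_coord (Ordinal l_gt1))).
  rewrite simple_coordN simple_coordD psi_q simple_coord_sum /simple_coord linear0.
  move=> /eqP; rewrite oppr_eq0 -natrD pnatr_eq0 addn_eq0 andbb => /eqP qm.
  by have := highest_coord_gt0 (Ordinal l_gt1); rewrite qm.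
Qed.

Lemma extended_relation : \sum_(i < l.+1) (qh i)%:R *: ah i = 0.
Proof.
rewrite big_ord_recl qh0 ah0 scale1r; apply/eqP; rewrite addrC subr_eq0; apply/eqP.
by apply: etrans (esym psi_q); apply: eq_bigr => i _; rewrite qhS ahS scaler_nat.
Qed.

(** These stand for the square roots of the [q i]; reality and the value of the square are all that
    is required of them. *)
Variable a : 'I_l.+1 -> C.
Hypothesis a_real : forall i, a i \is Num.real.
Hypothesis a_sqr : forall i, a i ^+ 2 = (qh i)%:R.

Let E := \sum_(i < l.+1) a i *: e (ah i).
Let star := star b_basis b_weight B_killing c_gt0 B_nondeg h_self t_dual e_root
  alpha_root alpha_span.
Let ew := e_weight e_root.
Let epair := e_pair e_root.
Let eform := e_form b_basis b_weight B_killing B_nondeg e_root.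
Let s_lin : forall k x y, star (k *: x + y) = k^* *: star x + star y.
Proof. exact: star_linear. Qed.
Let sK : forall x, star (star x) = x. Proof. exact: starK. Qed.
Let s_lie : forall x y, star (lie x y) = lie (star y) (star x). Proof. exact: star_lie. Qed.
Let s_form : forall x y, B (star x) (star y) = (B x y)^*. Proof. exact: form_star. Qed.
Let s_eq0 : forall x, B x (star x) = 0 -> x = 0. Proof. exact: star_eq0. Qed.
Let s_e beta : is_root beta -> star (e beta) = e (- beta). Proof. exact: star_e. Qed.
Let s_0 : star 0 = 0. Proof. exact: star0. Qed.
Let s_D x y : star (x + y) = star x + star y. Proof. exact: starD. Qed.
Let s_Z k x : star (k *: x) = k^* *: star x. Proof. exact: starZ. Qed.

Lemma star_cyclic : star E = \sum_(i < l.+1) a i *: e (- ah i).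
Proof.
rewrite /E (big_morph star s_D s_0); apply: eq_bigr => i _.
by rewrite s_Z (s_e (extended_root i)) (CrealP (a_real i)).
Qed.

Lemma lie_extended i j : i != j -> lie (e (ah i)) (e (- ah j)) = 0.
Proof.
move=> /extended_sub[ij0 ijr]; apply: (not_root_eq0 b_basis b_weight _ ij0 ijr).
by apply: in_root_space_lie; apply: ew; last apply: oppr; apply: extended_root.
Qed.

Lemma cyclic_normal : lie E (star E) = 0.
Proof.
rewrite star_cyclic /E lie_suml; transitivity (t (\sum_(i < l.+1) (qh i)%:R *: ah i)).
  have tl := t_linear b_basis b_weight B_killing B_nondeg h_self t_dual.
  have t0 : t 0 = 0 by have := tl (-1) 0 0; rewrite scaler0 addr0 scaleN1r addNr.
  have tD beta gamma : t (beta + gamma) = t beta + t gamma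
    by have := tl 1 beta gamma; rewrite !scale1r.
  have tZ k beta : t (k *: beta) = k *: t beta by have := tl k beta 0; rewrite t0 !addr0.
  rewrite (big_morph t tD t0); apply: eq_bigr => i _.
  rewrite linear_sum (bigD1 i) //= big1 ?addr0 => [|j ji].
    rewrite lieZl linearZ /= scalerA -expr2 a_sqr tZ; congr (_ *: _).
    have ri := extended_root i.
    rewrite (lie_opp b_basis b_weight B_killing B_nondeg h_self t_dual (ew ri) (ew (oppr ri))).
    by rewrite epair // scale1r.
  by rewrite lieZl linearZ /= lie_extended 1?eq_sym // !scaler0.
rewrite extended_relation.
have := t_linear b_basis b_weight B_killing B_nondeg h_self t_dual (-1) 0 0.
by rewrite scaler0 addr0 scaleN1r addNr.
Qed.

Lemma form_cyclic : B E E = 0.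
Proof.
rewrite /E (form_suml B_killing) big1 // => i _; rewrite (form_sumr B_killing) big1 // => j _.
rewrite BZl BZr (form_orth B_killing (ew (extended_root i)) (ew (extended_root j))) ?mulr0 //.
exact: extended_add_neq0.
Qed.

Lemma form_cyclic_star : B E (star E) = s%:R.
Proof.
rewrite star_cyclic /E (form_suml B_killing) natr_sum; apply: eq_bigr => i _.
have ri := extended_root i.
rewrite (form_sumr B_killing) (bigD1 i) //= big1 ?addr0 => [|j ji].
  by rewrite BZl BZr epair // mulr1 -expr2 a_sqr.
rewrite BZl BZr (eform (extended_root i) (extended_root j)).
case: eqVneq => [ij|]; last by rewrite !mulr0.
by have [] := extended_sub ji; rewrite ij subrr.
Qed.

(** * The grading by height modulo the Coxeter number *)

Definition height beta : C := \sum_i simple_coord i beta.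

Lemma heightD beta gamma : height (beta + gamma) = height beta + height gamma.
Proof. by rewrite -big_split; apply: eq_bigr => i _; rewrite simple_coordD. Qed.

Lemma heightN beta : height (- beta) = - height beta.
Proof. by rewrite -sumrN; apply: eq_bigr => i _; rewrite simple_coordN. Qed.

Lemma height0 : height 0 = 0.
Proof. by apply: (addrI (height 0)); rewrite -heightD !addr0. Qed.

Lemma height_sum (n : 'I_l -> nat) : height (\sum_(j < l) alpha j *+ n j) = (\sum_j n j)%N%:R.
Proof. by rewrite natr_sum; apply: eq_bigr => i _; rewrite simple_coord_sum. Qed.

Lemma height_extended i : exists z : int, height (ah i) = (1 + s%:Z * z)%:~R.
Proof.
case: (unliftP ord0 i) => [j ->|->].
  exists 0; rewrite ahS mulr0 addr0 /height (bigD1 j) //= big1 ?addr0 => [|k kj].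
    by rewrite simple_coord_alpha eqxx.
  by rewrite simple_coord_alpha eq_sym (negPf kj).
exists (-1); rewrite ah0 heightN psi_q height_sum coxeterE mulrN1.
by rewrite -addn1 PoszD opprD addrC subrK rmorphN.
Qed.

(** For a positive root, [psi - beta] has height at least 0, and [psi] has height [s - 1].
    Consequently no root has height divisible by [s]. *)
Lemma root_height beta : is_root beta ->
  exists m : int, [/\ height beta = m%:~R, m != 0 & (`|m| < s)%N].
Proof.
have pos (n : 'I_l -> nat) gamma : gamma = \sum_(i < l) alpha i *+ n i -> is_root gamma ->
    height gamma = (\sum_i n i)%N%:R /\ (0 < \sum_i n i < s)%N.
  move=> E1 r; rewrite {1}E1 height_sum; split=> //; apply/andP; split.
    rewrite lt0n; apply/eqP => /eqP; rewrite sum_nat_eq0 => /forallP n0.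
    by case: r => + _; case; rewrite E1 big1 // => i _; have /eqP -> := n0 i.
  have [_ /(_ _ r)[n' /(congr1 height)]] := psi_highest.
  rewrite heightD heightN psi_q {1}E1 !height_sum => /(canRL (subrK _)) /eqP.
  by rewrite -natrD eqr_nat coxeterE ltnS => /eqP ->; apply: leq_addl.
move=> r; have [_ _ /(_ _ r)[n [E1|E1]]] := alpha_simple.
  have [-> /andP[n0 ns]] := pos n beta E1 r.
  by exists (\sum_i n i)%N%:Z; split=> //; rewrite -lt0n.
have [|H /andP[n0 ns]] := pos n (- beta) _ (oppr r); first by rewrite E1 opprK.
exists (- (\sum_i n i)%N%:Z); rewrite oppr_eq0 -lt0n abszN; split=> //.
by rewrite rmorphN -[beta]opprK heightN H.
Qed.

Definition degree_is (k : int) beta : bool :=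
  boolp.asbool (exists z : int, height beta = (k + s%:Z * z)%:~R).

Lemma degreeP k beta :
  reflect (exists z : int, height beta = (k + s%:Z * z)%:~R) (degree_is k beta).
Proof. exact: boolp.asboolP. Qed.

Lemma degreeD i j beta gamma :
  degree_is i beta -> degree_is j gamma -> degree_is (i + j) (beta + gamma).
Proof.
move=> /degreeP[z1 E1] /degreeP[z2 E2]; apply/degreeP; exists (z1 + z2).
by rewrite heightD E1 E2 -rmorphD mulrDr addrACA.
Qed.

Lemma degreeN i beta : degree_is i beta -> degree_is (- i) (- beta).
Proof.
by move=> /degreeP[z E1]; apply/degreeP; exists (- z); rewrite heightN E1 -rmorphN opprD mulrN.
Qed.

Lemma degree_per i beta : degree_is (i + s%:Z) beta = degree_is i beta.
Proof.
apply/degreeP/degreeP => -[z ->]; [exists (1 + z)|exists (z - 1)].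
  by rewrite mulrDr mulr1 addrA.
by rewrite mulrBr mulr1 addrA addrAC addrK.
Qed.

Lemma degree_extended i : degree_is 1 (ah i).
Proof. exact/degreeP/height_extended. Qed.

Lemma weight_height i : exists m : int, height (w i) = m%:~R.
Proof.
case: (boolp.pselect (w i = 0)) => [->|/(weight_root b_basis b_weight) r].
  by exists 0; rewrite height0.
by have [m [-> _ _]] := root_height r; exists m.
Qed.

Lemma degree0_weight i : degree_is 0 (w i) -> w i = 0.
Proof.
case: (boolp.pselect (w i = 0)) => // /(weight_root b_basis b_weight) r.
have [m [E1 m0 ms]] := root_height r; move=> /degreeP[z]; rewrite E1 add0r => /intr_inj mz.
move: m0 ms; rewrite mz abszM /= mulf_eq0 negb_or => /andP[_ z0].
by rewrite -[X in (_ < X)%N]muln1 ltn_mul2l andbC ltnNge absz_gt0 z0.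
Qed.

Definition degree_proj (k : int) := weight_op b w (fun beta => (degree_is k beta)%:R : C).

Definition homogeneous k x := degree_proj k x = x.

Lemma degree_projE k x : degree_proj k x = \sum_(i | degree_is k (w i)) coord b i x *: b`_i.
Proof.
rewrite /degree_proj weight_opE [RHS]big_mkcond; apply: eq_bigr => i _.
by case: ifP => _; rewrite ?mul1r ?mul0r ?scale0r.
Qed.

Lemma homogeneous_weight k beta x :
  in_root_space beta x -> degree_is k beta -> homogeneous k x.
Proof.
move=> bx kb; rewrite /homogeneous /degree_proj.
by rewrite (weight_op_weight b_basis b_weight _ bx) kb scale1r.
Qed.

Lemma homogeneous_sum (I : Type) (r : seq I) (P : pred I) (F : I -> g) k :
  (forall i, P i -> homogeneous k (F i)) -> homogeneous k (\sum_(i <- r | P i) F i).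
Proof.
by move=> hF; rewrite /homogeneous linear_sum; apply: eq_bigr => i Pi; apply: hF.
Qed.

Lemma homogeneousZ k m x : homogeneous k x -> homogeneous k (m *: x).
Proof. by rewrite /homogeneous => hx; rewrite linearZ /= hx. Qed.

Lemma homogeneous_lie i j x y :
  homogeneous i x -> homogeneous j y -> homogeneous (i + j) (lie x y).
Proof.
rewrite {1 2}/homogeneous !degree_projE => <- <-; rewrite lie_suml.
apply: homogeneous_sum => m mi; rewrite linear_sum; apply: homogeneous_sum => n nj /=.
rewrite lieZl linearZ /=; do 2 apply: homogeneousZ.
apply: homogeneous_weight (degreeD mi nj).
exact: in_root_space_lie.
Qed.

Lemma star_weight i : in_root_space (- w i) (star b`_i).
Proof.
case: (boolp.pselect (w i = 0)) => [wi|/(weight_root b_basis b_weight) r].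
  rewrite wi oppr0; apply/h_self.
  apply: (orth_cartan b_basis b_weight B_killing c_gt0 B_nondeg h_self t_dual e_root) => beta rb.
  rewrite -[beta]opprK -s_e; last exact: oppr.
  rewrite s_form (e_form_cartan B_killing h_self e_root) ?rmorph0 //; first exact: oppr.
  by apply/h_self; rewrite -wi.
rewrite (e_line b_basis b_weight B_killing c_gt0 B_nondeg h_self t_dual e_root r (b_weight i)).
by rewrite s_Z s_e //; apply: in_root_spaceZ; apply/ew/oppr.
Qed.

Lemma homogeneous_star i x : homogeneous i x -> homogeneous (- i) (star x).
Proof.
rewrite {1}/homogeneous degree_projE => <-; rewrite (big_morph star s_D s_0).
apply: homogeneous_sum => j ji; rewrite s_Z; apply: homogeneousZ.
exact: homogeneous_weight (star_weight j) (degreeN ji).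
Qed.

Lemma homogeneous_per i x : homogeneous (i + s%:Z) x -> homogeneous i x.
Proof.
rewrite /homogeneous !degree_projE => {2}<-.
by apply: eq_bigl => j; rewrite degree_per.
Qed.

(** Every weight has integral height, hence belongs to exactly one residue class modulo [s]. *)
Lemma degree_proj_sum x : x = \sum_(k < s) degree_proj k%:Z x.
Proof.
rewrite {1}(basis_expand b_basis x).
under [RHS]eq_bigr do rewrite degree_projE big_mkcond.
rewrite exchange_big; apply: eq_bigr => i _ /=.
have [m mE] := weight_height i.
have s0 : s%:Z != 0 by rewrite coxeterE.
have [k km] : exists k : 'I_s, k%:Z = (m %% s%:Z)%Z.
  have lt : (`|(m %% s%:Z)%Z| < s)%N.
    by rewrite -ltz_nat gez0_abs ?modz_ge0 // ltz_pmod // coxeterE.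
  by exists (Ordinal lt); rewrite /= gez0_abs ?modz_ge0.
rewrite (bigD1 k) //= big1 ?addr0 => [|k' k'k].
  case: ifP => // /degreeP[]; exists (m %/ s%:Z)%Z.
  by rewrite mE km addrC mulrC -divz_eq.
case: ifP => // /degreeP[z]; rewrite mE => /intr_inj mz.
case/eqP: k'k; apply: val_inj => /=; apply/eqP; rewrite -eqz_nat km mz addrC mulrC modzMDl.
by rewrite modz_small //= ltz_nat ltn_ord.
Qed.

Lemma degree_proj_homogeneous k x : homogeneous k%:Z (degree_proj k%:Z x).
Proof.
rewrite degree_projE; apply: homogeneous_sum => i ki.
exact/homogeneousZ/homogeneous_weight.
Qed.

(** [E] has degree 1, so [ad E] shifts degrees by 1; hence the centralizer contains the components
    of its elements. *)
Lemma lie_cyclic_proj k x : lie E (degree_proj k x) = degree_proj (k + 1) (lie E x).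
Proof.
rewrite /E !lie_suml linear_sum; apply: eq_bigr => i _; rewrite !lieZl linearZ /=.
congr (_ *: _); rewrite {2}(basis_expand b_basis x) degree_projE big_mkcond !linear_sum.
apply: eq_bigr => j _ /=; rewrite [lie _ (_ *: b`_j) in RHS]linearZ /= linearZ /=.
have ew' := in_root_space_lie (ew (extended_root i)) (b_weight j).
rewrite /degree_proj (weight_op_weight b_basis b_weight _ ew').
have -> : degree_is (k + 1) (ah i + w j) = degree_is k (w j).
  apply/idP/idP => [H|H]; last by rewrite [ah i + _]addrC; apply: degreeD (degree_extended i).
  have := degreeD H (degreeN (degree_extended i)).
  by rewrite addrK addrAC subrr add0r.
by case: ifP => _; rewrite ?scale1r ?scale0r ?scaler0 ?linear0 ?linearZ.
Qed.

Lemma degree_proj_centralizer k x : lie E x = 0 -> lie E (degree_proj k%:Z x) = 0.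
Proof. by move=> Ex; rewrite lie_cyclic_proj Ex linear0. Qed.

(** No root has degree 0, so [x] is in [h]. Pairing [lie E x = 0] with [e (- ah i)] leaves, up to
    sign, [a i] times the value of [ah i] at [x], and [a i] is nonzero because [q i > 0]; so all
    simple roots vanish at [x]. *)
Lemma homogeneous0 x : homogeneous 0 x -> lie E x = 0 -> x = 0.
Proof.
move=> x0 Ex; have xh : x \in h.
  rewrite -x0 degree_projE rpred_sum // => i /degree0_weight wi.
  by apply/rpredZ/h_self; rewrite -wi.
have ax i : eval_dual (ah i) x = 0.
  have := congr1 (fun y => B y (e (- ah i))) Ex.
  rewrite (form0l B_killing) /E lie_suml (form_suml B_killing) (bigD1 i) //= big1 => [|j ji].
    rewrite addr0 lieZl BZl lieC (ew (extended_root i)) // (formNl B_killing) BZl.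
    rewrite (epair (extended_root i)).
    rewrite mulr1 => /eqP; rewrite mulf_eq0 oppr_eq0 => /orP[/eqP ai|/eqP //].
    have /eqP := a_sqr i; rewrite ai expr0n eq_sym pnatr_eq0 => /eqP qi.
    by have := extended_coord_gt0 i; rewrite qi.
  rewrite lieZl BZl lieC (ew (extended_root j)) // (formNl B_killing) BZl.
  rewrite (eform (extended_root j) (extended_root i)).
  case: eqVneq => [ij|]; last by rewrite mulr0 oppr0 mulr0.
  by have [] := extended_sub ji; rewrite ij subrr.
apply: B_nondeg.
apply: (root_span_ind b_basis b_weight B_killing c_gt0 B_nondeg h_self t_dual e_root alpha_root alpha_span).
- exact: form0l.
- by move=> k y z Ey Ez; rewrite (form_linl B_killing) Ey Ez mulr0 addr0.
- by move=> beta rb; rewrite BC (e_form_cartan B_killing h_self e_root).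
- move=> beta rb; rewrite BC (form_t t_dual) //; have [k ->] := alpha_span beta.
  rewrite eval_dual_sum big1 // => i _; rewrite /eval_dual scale_lfunE.
  by have := ax (lift ord0 i); rewrite ahS /eval_dual => ->; rewrite scaler0.
Qed.

Lemma cyclic_centralizer_abelian : is_abelian (centralizer E).
Proof.
exact: (centralizer_abelian B_killing s_lin sK s_lie s_eq0 cyclic_normal homogeneous_lie
  homogeneous_star homogeneous_per degree_proj_sum degree_proj_homogeneous
  degree_proj_centralizer homogeneous0).
Qed.

(** The interface to the plane: beyond this point [h] and its roots are forgotten. *)
Lemma cyclic_element : exists star : g -> g,
  [/\ forall k x y, star (k *: x + y) = k^* *: star x + star y,
      forall x, star (star x) = x,
      forall x y, star (lie x y) = lie (star y) (star x),
      forall x y, B (star x) (star y) = (B x y)^*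
    & forall x, B x (star x) = 0 -> x = 0] /\
  [/\ lie E (star E) = 0, is_abelian (centralizer E), B E E = 0
    & B E (star E) = s%:R].
Proof.
exists star; split; split.
- exact: s_lin.
- exact: sK.
- exact: s_lie.
- exact: s_form.
- exact: s_eq0.
- exact: cyclic_normal.
- exact: cyclic_centralizer_abelian.
- exact: form_cyclic.
- exact: form_cyclic_star.
Qed.

End CyclicElement.

Local Open Scope complex_scope.

(** * The Coxeter plane *)

(** Adjoining to [h] a vector that commutes with it leaves it abelian, so maximality applies. *)
Lemma cartan_self (K : fieldType) (g : lieAlgType K) (h : {vspace g}) : is_cartan h ->
  forall x : g, in_root_space (0 : dual h) x <-> x \in h.
Proof.
move=> [h_ab h_max _] x; split=> [x0|xh y yh]; last first.
  by rewrite eval_dual0l scale0r h_ab.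
have yx y : y \in h -> lie y x = 0.
  by move=> yh; rewrite x0 // eval_dual0l scale0r.
suff <- : (h + <[x]>)%VS = h by rewrite (subvP (addvSr _ _)) // memv_line.
apply: h_max; last exact: addvSl.
move=> _ _ /memv_addP[y yh [_ /vlineP[k ->] ->]] /memv_addP[z zh [_ /vlineP[k' ->] ->]].
rewrite lieDl linearD /= h_ab // add0r linearZ /= yx // scaler0 add0r.
by rewrite lieZl linearD /= linearZ /= liexx scaler0 addr0 lieC yx // oppr0 scaler0.
Qed.

Section CoxeterPlane.
Variables (R : realType) (g : lieAlgType R[i]) (c : R[i]) (B : g -> g -> R[i]).
Hypothesis B_killing : forall x y, B x y = c * killing x y.
Hypothesis B_nondeg : forall x, (forall y, B y x = 0) -> x = 0.
Variable star : g -> g.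
Hypothesis star_linear : forall a x y, star (a *: x + y) = (a^*)%R *: star x + star y.
Hypothesis starK : forall x, star (star x) = x.
Hypothesis star_lie : forall x y, star (lie x y) = lie (star y) (star x).
Hypothesis form_star : forall x y, B (star x) (star y) = ((B x y)^*)%R.
Hypothesis star_eq0 : forall x, B x (star x) = 0 -> x = 0.
Variables (E : g) (s : nat).
Hypothesis s_gt0 : (0 < s)%N.
Hypothesis E_normal : lie E (star E) = 0.
Hypothesis E_abelian : is_abelian (centralizer E).
Hypotheses (form_E : B E E = 0) (form_E_star : B E (star E) = s%:R).

Local Notation h' := (centralizer E).
Local Notation sharp := (real_part h').
Let r : R := Num.sqrt (2 / s%:R).

Let BDl := formDl B_killing.
Let BDr := formDr B_killing.
Let BZl := formZl B_killing.
Let BZr := formZr B_killing.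
Let BNl := formNl B_killing.
Let BC := formC B_killing.

Lemma conjC_i : (('i%C : R[i])^*)%R = - 'i%C.
Proof. by apply/eqP; rewrite eq_complex /= oppr0 !eqxx. Qed.

Lemma star_sharp x : x \in h' -> star x = x -> sharp x.
Proof.
move=> xh sx; split=> // beta rb.
exact: (self_adjoint_root_real B_killing star_linear starK star_lie star_eq0 E_normal rb xh sx).
Qed.

Lemma sharp_star x : sharp x -> star x = x.
Proof.
move=> [xh xr]; apply/eqP; rewrite -subr_eq0; apply/eqP.
have sxh : star x \in h'.
  by apply/centralizerP/(centralizer_star B_killing star_linear starK star_lie star_eq0 E_normal)/centralizerP.
apply: (centralizer_root_ext B_killing B_nondeg star_linear starK star_lie star_eq0
  E_normal E_abelian) => [|beta rb]; first exact: rpredB.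
rewrite -scaleN1r addrC eval_dualP mulN1r.
rewrite (root_star B_killing star_linear starK star_lie star_eq0 E_normal rb xh).
by rewrite (CrealP (xr _ rb)) addNr.
Qed.

Lemma two_neq0 : (2%:R : R[i]) != 0. Proof. by rewrite pnatr_eq0. Qed.

Lemma i_neq0 : ('i%C : R[i]) != 0.
Proof. by rewrite eq_complex /= oner_eq0 andbF. Qed.

Lemma cyclic_real_imag : exists ReE ImE : g,
  [/\ sharp ReE, sharp ImE & E = ReE + 'i%C *: ImE].
Proof.
have Eh : E \in h' by apply/centralizerP/liexx.
have sEh : star E \in h' by apply/centralizerP.
(* The self-adjoint and anti-self-adjoint parts of [E], as for a normal operator. *)
exists (2^-1 *: (E + star E)), ((2 * 'i%C)^-1 *: (E - star E)); split.
- apply: star_sharp; first by rewrite rpredZ ?rpredD.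
  rewrite (antilinearZ star_linear) (antilinearD star_linear) starK addrC.
  by rewrite fmorphV rmorph_nat.
- apply: star_sharp; first by rewrite rpredZ ?rpredB.
  rewrite (antilinearZ star_linear) (antilinearD star_linear) (antilinearN star_linear) starK.
  by rewrite fmorphV rmorphM rmorph_nat /= conjC_i mulrN invrN scaleNr -scalerN opprB.
rewrite scalerA invfM mulrCA mulfV ?i_neq0 // mulr1 -scalerDr addrACA subrr addr0.
by rewrite -mulr2n -[E *+ 2]scaler_nat scalerA mulVf ?two_neq0 // scale1r.
Qed.

Variables ReE ImE : g.
Hypotheses (Re_sharp : sharp ReE) (Im_sharp : sharp ImE) (E_ReIm : E = ReE + 'i%C *: ImE).

Let sqr_i : ('i%C * 'i%C : R[i]) = -1. Proof. by rewrite -expr2 sqr_i. Qed.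

(** With [x], [y], [z] the three entries, [B E E = 0] reads [x - y + 2iz = 0] and [B E (star E) = s]
    reads [x + y = s]. Elements of [sharp] are fixed by [star], so the entries are real, and
    conjugating the first equation separates [x = y] from [z = 0]. *)
Lemma plane_gram :
  [/\ B ReE ReE = s%:R / 2, B ImE ImE = s%:R / 2 & B ReE ImE = 0].
Proof.
have sE : star E = ReE - 'i%C *: ImE.
  rewrite E_ReIm (antilinearD star_linear) (antilinearZ star_linear) conjC_i.
  by rewrite !sharp_star // scaleNr.
have := form_E; have := form_E_star; rewrite sE E_ReIm.
rewrite !(BDl, BDr, BZl, BZr, BNl, formNr B_killing) (BC ImE ReE).
set x := B ReE ReE; set y := B ImE ImE; set z := B ReE ImE => F2 F1.
have conj_z : (z^*)%R = z by rewrite -form_star !sharp_star.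
have conj_x : (x^*)%R = x by rewrite -form_star !sharp_star.
have conj_y : (y^*)%R = y by rewrite -form_star !sharp_star.
have F1' : x - y + 2 * 'i%C * z = 0 by rewrite -F1; ring: sqr_i.
have F2' : x + y = s%:R by rewrite -F2; ring: sqr_i.
have F3 : x - y - 2 * 'i%C * z = 0.
  have := congr1 (fun u : R[i] => (u^*)%R) F1'.
  by rewrite rmorph0 !rmorphD !rmorphM rmorphN /= conjC_i conj_x conj_y conj_z rmorph_nat mulrN mulNr.
have xy : x = y.
  apply/eqP; rewrite -subr_eq0 -(mulrI_eq0 _ (mulfI two_neq0)).
  have -> : 2 * (x - y) = x - y + 2 * 'i%C * z + (x - y - 2 * 'i%C * z) by ring.
  by rewrite F1' F3 addr0.
have z0 : z = 0.
  move/eqP: F1'; rewrite xy subrr add0r !mulf_eq0 (negPf two_neq0) (negPf i_neq0) /=.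
  by move/eqP.
have y2 : y = s%:R / 2 by apply: (canRL (mulfK two_neq0)); rewrite -F2' xy; ring.
by rewrite z0 xy y2.
Qed.

Let sC : (s%:R : R[i]) != 0. Proof. by rewrite pnatr_eq0 -lt0n. Qed.

Lemma sqr_scale : r%:C ^+ 2 = 2 / s%:R.
Proof.
rewrite -rmorphXn /= sqr_sqrtr ?divr_ge0 ?ler0n //.
by rewrite rmorphM fmorphV !rmorph_nat.
Qed.

Lemma scaled_orthonormal : orthonormal_pair B (r%:C *: ReE) (r%:C *: ImE).
Proof.
have [Bxx Byy Bxy] := plane_gram.
split; rewrite BZl BZr mulrA -expr2 sqr_scale ?Bxx ?Byy ?Bxy ?mulr0 //.
  by field.
by field.
Qed.

Lemma form_real x y : star x = x -> star y = y -> exists k : R, B x y = k%:C.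
Proof.
by move=> sx sy; apply/complex_realP/CrealP; rewrite -form_star sx sy.
Qed.

Lemma plane_projection_exists :
  exists Q : g -> g, is_orthogonal_projection B sharp (plane ReE ImE) Q.
Proof.
have [Bxx Byy Bxy] := plane_gram.
exists (fun x => (2 / s%:R * B x ReE) *: ReE + (2 / s%:R * B x ImE) *: ImE) => x xs.
have [k1 E1] := form_real (sharp_star xs) (sharp_star Re_sharp).
have [k2 E2] := form_real (sharp_star xs) (sharp_star Im_sharp).
split.
  exists (2 / s%:R * k1), (2 / s%:R * k2); rewrite E1 E2.
  by rewrite !rmorphM !fmorphV !rmorph_nat.
move=> _ [k3 [k4 ->]]; rewrite !(BDl, BDr, BZl, BZr, BNl) (BC ImE ReE) Bxx Byy Bxy.
by field.
Qed.

(** Orthogonality of [H - Q H] to the plane makes the coordinates of [Q H] along [ReE] and [ImE]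
    equal to [2 / s] times the values of [beta] there. These values are real, so they are the real
    and imaginary parts of [beta] at [E]; the factor [2 / s = r ^+ 2] is shared between the basis
    vectors and the coordinates. *)
Lemma projection_dual_vector (Q : g -> g) (beta : dual h') (H : g) :
  is_orthogonal_projection B sharp (plane ReE ImE) Q -> is_root beta ->
  is_dual_vector B beta H -> sharp H /\
  Q H = point_of_complex (r%:C *: ReE) (r%:C *: ImE) (r%:C * eval_dual beta E).
Proof.
move=> QP rb HP; have [Hh HB] := HP; have [Bxx Byy Bxy] := plane_gram.
have Hs : sharp H.
  apply: star_sharp => //.
  exact: (dual_vector_star B_killing star_linear starK star_lie form_star star_eq0 E_normal rb HP).
split=> //; have [[k1 [k2 QE]] Qorth] := QP _ Hs.
have inY1 : plane ReE ImE ReE by exists 1, 0; rewrite scale1r scale0r addr0.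
have inY2 : plane ReE ImE ImE by exists 0, 1; rewrite scale1r scale0r add0r.
have [Reh Rer] := Re_sharp; have [Imh Imr] := Im_sharp.
have /complex_realP[m1 mE1] := Rer _ rb; have /complex_realP[m2 mE2] := Imr _ rb.
have B1 : k1%:C = 2 / s%:R * m1%:C.
  have := Qorth _ inY1; rewrite QE !(BDl, BDr, BZl, BZr, BNl) (BC ImE ReE) Bxx Bxy.
  rewrite (BC H) HB // mE1 mulr0 addr0 => /eqP; rewrite subr_eq0 => /eqP ->.
  by field; rewrite sC.
have B2 : k2%:C = 2 / s%:R * m2%:C.
  have := Qorth _ inY2; rewrite QE !(BDl, BDr, BZl, BZr, BNl) Byy Bxy.
  rewrite (BC H) HB // mE2 mulr0 add0r => /eqP; rewrite subr_eq0 => /eqP ->.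
  by field; rewrite sC.
have bE : r%:C * eval_dual beta E = (r * m1) +i* (r * m2).
  have -> : eval_dual beta E = eval_dual beta (ReE + 'i%C *: ImE).
    exact: congr1 E_ReIm.
  rewrite eval_dualDr eval_dualZ mE1 mE2.
  by apply/eqP; rewrite eq_complex /=; apply/andP; split; apply/eqP; ring.
rewrite /point_of_complex bE /= !scalerA QE B1 B2 !rmorphM /=.
by rewrite ![_ * _ * r%:C]mulrAC -expr2 sqr_scale.
Qed.

End CoxeterPlane.

(** The existence of the decomposition of [E_+], of [Q] and of [H] is part of the conclusion, and
    the identity is asserted for every choice of them. *)
Theorem propositionB1 (R : realType) (g : lieAlgType R[i])
    (h : {vspace g}) (l : nat)
    (alpha : 'I_l -> dual h) (psi : dual h) (q : 'I_l -> nat)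
    (c : R) (B : g -> g -> R[i])
    (e : dual h -> g) (N : dual h -> dual h -> R[i])
    (g_simple : is_simple g)
    (h_cartan : is_cartan h)
    (rank_l : \dim h = l)
    (l_gt1 : (1 < l)%N)
    (alpha_simple : is_simple_system alpha)
    (psi_highest : is_highest_root alpha psi)
    (psi_q : psi = \sum_(i < l) alpha i *+ q i)
    (c_gt0 : 0 < c)
    (B_killing : forall x y : g, B x y = c%:C * killing x y)
    (e_root : is_root_vectors B e N) :
  let s := coxeter_number q in
  let Ep := E_plus e alpha psi q in
  let h' := centralizer Ep in
  let h'_sharp := real_part h' in
  let r := Num.sqrt (2 / s%:R) : R in
  (exists ReE ImE : g,
     [/\ h'_sharp ReE, h'_sharp ImE & Ep = ReE + 'i%C *: ImE]) /\
  (forall ReE ImE : g,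
     h'_sharp ReE -> h'_sharp ImE -> Ep = ReE + 'i%C *: ImE ->
     let Y := plane ReE ImE in
     let u := r%:C *: ReE in
     let v := r%:C *: ImE in
     [/\ orthonormal_pair B u v,
         exists Q : g -> g, is_orthogonal_projection B h'_sharp Y Q
       & forall (Q : g -> g) (beta : dual h'),
           is_orthogonal_projection B h'_sharp Y Q -> is_root beta ->
           (exists H : g, is_dual_vector B beta H) /\
           (forall H : g, is_dual_vector B beta H ->
              h'_sharp H /\
              Q H = point_of_complex u v (r%:C * eval_dual beta Ep))]).
Proof.
have h_self := cartan_self h_cartan; have [h_ab _ h_diag] := h_cartan.
have [b [w [b_basis b_weight]]] := weight_basis h_ab h_diag.
have c_gt0' : 0 < c%:C by rewrite ltcR.
(* In place of Cartan's criterion: the normalization of the root vectors shows [B] to be nonzero,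
   and simplicity does the rest. *)
have B_nondeg : forall x, (forall y, B y x = 0) -> x = 0.
  apply: (simple_form_nondeg B_killing g_simple).
  have [alpha_root _ _] := alpha_simple; have [_ e_pair _] := e_root.
  exists (e (alpha (Ordinal l_gt1))), (e (- alpha (Ordinal l_gt1))).
  by rewrite e_pair //; apply/eqP; rewrite oner_eq0.
have [t t_dual] := boolp.choice
  (dual_vector_exists b_basis b_weight B_killing B_nondeg h_self).
have a_real i : (Num.sqrt ((extend0 1%N q i)%:R : R))%:C \is Num.real.
  by apply/complex_realP; exists (Num.sqrt ((extend0 1%N q i)%:R : R)).
have a_sqr i : (Num.sqrt ((extend0 1%N q i)%:R : R))%:C ^+ 2 = (extend0 1%N q i)%:R.
  by rewrite -rmorphXn /= sqr_sqrtr ?ler0n // rmorph_nat.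
have [star [[s_lin sK s_lie s_form s_eq0] [E_normal E_ab E_E E_sE]]] :=
  cyclic_element b_basis b_weight B_killing c_gt0' B_nondeg h_self t_dual e_root l_gt1
    alpha_simple psi_highest psi_q a_real a_sqr.
have s_gt0 : (0 < coxeter_number q)%N by rewrite coxeterE.
move=> s Ep h' h'_sharp r; split.
  exact: (cyclic_real_imag B_killing s_lin sK s_lie s_eq0 E_normal).
move=> ReE ImE Re_s Im_s E_ReIm Y u v; split.
- exact: (scaled_orthonormal B_killing B_nondeg s_lin sK s_lie s_form s_eq0 s_gt0
    E_normal E_ab E_E E_sE Re_s Im_s E_ReIm).
- exact: (plane_projection_exists B_killing B_nondeg s_lin sK s_lie s_form s_eq0 s_gt0
    E_normal E_ab E_E E_sE Re_s Im_s E_ReIm).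
move=> Q beta QP rb; split.
  exact: (centralizer_dual_vector B_killing s_lin sK s_lie s_eq0 E_normal beta).
move=> H; exact: (projection_dual_vector B_killing B_nondeg s_lin sK s_lie s_form s_eq0 s_gt0
    E_normal E_ab E_E E_sE Re_s Im_s E_ReIm QP rb).
Qed.
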